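(* For $p>1$ and $x>0$ let $\zeta(p,x)=\sum_{k=0}^\infty\frac{1}{(k+x)^p}$ be the Hurwitz zeta function. Let $n\ge 2$ and let $\boldsymbol{p}=(p_1,\dots,p_n)$, $\boldsymbol{q}=(q_1,\dots,q_n)\in(1,\infty)^n$ satisfy $\boldsymbol{p}\prec\boldsymbol{q}$. For real $\lambda_n$ put $$\mathcal{D}(x;\lambda_n)=\prod_{j=1}^n\zeta(p_j,x)-\lambda_n\prod_{j=1}^n\zeta(q_j,x).$$ Then $x\mapsto\mathcal{D}(x;\lambda_n)$ is completely monotonic on $(0,\infty)$ if and only if $$\lambda_n\le\prod_{j=1}^n\frac{q_j-1}{p_j-1},$$ while $x\mapsto-\mathcal{D}(x;\lambda_n)$ is completely monotonic on $(0,\infty)$ if and only if $\lambda_n\ge 1$. Consequently, the double inequality $$\prod_{j=1}^n\frac{q_j-1}{p_j-1}<\prod_{j=1}^n\frac{\zeta(p_j,x)}{\zeta(q_j,x)}<1$$ holds for all $x>0$, and the lower and upper bounds are sharp (neither constant can be improved).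
   Context: A function $h$ is completely monotonic on an interval $I$ if it has derivatives of all orders on $I$ and $(-1)^m h^{(m)}(x)\ge 0$ for all integers $m\ge 0$ and all $x\in I$. For $x=(x_1,\dots,x_n)$ and $y=(y_1,\dots,y_n)$ in $\mathbb{R}^n$, $y\prec x$ means: $x\ne y$, $x_1\ge x_2\ge\cdots\ge x_n$, $y_1\ge y_2\ge\cdots\ge y_n$, $\sum_{j=1}^{m}x_j\ge\sum_{j=1}^{m}y_j$ for $m=1,\dots,n-1$, and $\sum_{j=1}^n x_j=\sum_{j=1}^n y_j$. *)

(* Defs.v *)
From HB Require Import structures.
From mathcomp Require Import all_boot all_order all_algebra.
From mathcomp Require Import all_classical all_reals all_analysis.

Set Implicit Arguments.
Unset Strict Implicit.
Unset Printing Implicit Defensive.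

Import Order.TTheory GRing.Theory Num.Theory.
Import numFieldNormedType.Exports.

Local Open Scope classical_set_scope.
Local Open Scope ring_scope.

(* The limit exists for 1 < p and 0 < x, the only range in which the function
   is meant to be used. *)
Definition hurwitz_zeta (R : realType) (p x : R) : R :=
  limn (series (fun k : nat => 1 / (k%:R + x) `^ p)).

(* Derivatives are two-sided, so [I] is meant to be an open interval. *)
Definition completely_monotonic (R : realType) (I : set R) (h : R -> R) : Prop :=
  (forall (m : nat) (x : R), I x -> derivable (derive1n m h) x 1) /\
  (forall (m : nat) (x : R), I x -> 0 <= (-1) ^+ m * derive1n m h x).

Definition nonincreasing_vec (R : realType) (n : nat) (x : 'rV[R]_n) : Prop :=
  forall i j : 'I_n, (i <= j)%N -> x ord0 j <= x ord0 i.

(* [majorized y x] is $y \prec x$.  Coordinates are numbered from 0, so the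
   first m of them are those with index j < m. *)
Definition majorized (R : realType) (n : nat) (y x : 'rV[R]_n) : Prop :=
  [/\ x <> y,
      nonincreasing_vec x,
      nonincreasing_vec y,
      forall m : nat, (1 <= m <= n.-1)%N ->
        \sum_(j < n | (j < m)%N) y ord0 j <= \sum_(j < n | (j < m)%N) x ord0 j
    & \sum_(j < n) x ord0 j = \sum_(j < n) y ord0 j].

Definition zeta_prod_diff (R : realType) (n : nat) (p q : 'rV[R]_n)
    (lambda x : R) : R :=
  \prod_(j < n) hurwitz_zeta (p ord0 j) x
  - lambda * \prod_(j < n) hurwitz_zeta (q ord0 j) x.

(* Main.v *)
Require Import Defs.
From HB Require Import structures.
From mathcomp Require Import all_boot all_order all_algebra.
From mathcomp Require Import all_classical all_reals all_analysis.
From mathcomp Require Import measurable_realfun.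
From mathcomp Require Import ring lra.

Set Implicit Arguments.
Unset Strict Implicit.
Unset Printing Implicit Defensive.

Import Order.TTheory GRing.Theory Num.Theory.
Import numFieldNormedType.Exports.

Local Open Scope classical_set_scope.
Local Open Scope ring_scope.

(** The theorem rests on Laplace transforms: a function of the form
    x |-> int_0^oo k(t) e^{-xt} dt with k >= 0 is completely monotonic, and it is
    either identically zero or everywhere positive.  Functions of this form are
    stable under sums, nonnegative multiples and products
    (laplace_representableM).  So it is enough to exhibit a nonnegative density
    for prod zeta(q_j,x) - prod zeta(p_j,x), and for the same difference with the
    roles of p and q exchanged and zeta(p,x) replaced by (p-1) zeta(p,x).

    A majorization p < q is a chain of transfers between two coordinates
    (majorization_ind), which reduces everything to n = 2 with a + b = a' + b' and
    b' <= a, b <= a'.  Put chi(t) = 1/(1 - e^{-t}).  Then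

      Gamma(p) zeta(p,x)         = int t^{p-1} chi(t) e^{-xt} dt,
      Gamma(p-1) (p-1) zeta(p,x) = int t^{p-2} (t chi(t)) e^{-xt} dt.

    More generally let F_a(x) = Gamma(a)^{-1} int t^{a-1} theta(t) e^{-xt} dt.  In
    the coordinates u = t/(1+r), w = tr/(1+r), the product F_a F_b has, up to a
    factor 2, the density

      t^{a+b-1} int_0^oo theta(u) theta(w) h_{a,b}(r) dr,

    where h_{a,b} is a symmetrized beta density, of total mass 2/Gamma(a+b)
    (laplace_pair, integral_beta_density).  For (a,b) and (a',b') with the same
    sum, the two densities h have the same mass, and h_{a',b'}/h_{a,b} increases
    with |log r|: passing to (a',b') moves mass away from the diagonal u = w
    (beta_density_crossing).  When theta(u) theta(w), for fixed u + w, increases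
    towards the diagonal, F_a F_b therefore has the larger density; when it
    decreases, F_a' F_b' does (single_crossing_integral_le,
    pair_difference_representable).  The function theta = chi decreases towards the
    diagonal because (1 - e^{-u})(1 - e^{-w}) = 1 + e^{-(u+w)} - e^{-u} - e^{-w};
    theta = t chi(t) increases because it is log-concave, which amounts to
    sinh(t/2) >= t/2.

    The constants are sharp because of
      max(x^{-p}, x^{1-p}/(p-1)) <= zeta(p,x) <= x^{-p} + x^{1-p}/(p-1)
    (hurwitz_bounds, a consequence of 1 <= t chi(t) <= 1 + t and 1 <= chi(t)).
    As sum p_j = sum q_j, the quotient prod zeta(p_j,x)/zeta(q_j,x) tends to 1 at 0
    and to kappa = prod (q_j-1)/(p_j-1) at infinity; and kappa < 1 as p <> q.  The
    inequalities are strict since a representable function that vanishes at one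
    point vanishes everywhere, which would make this quotient constant and its two
    limits equal. *)

(** * Lebesgue integrals: scaling and improper integrals *)

(** Packaging the image measure as a measure whose integrals are computed by
    substitution, so that uniqueness of Lebesgue measure applies to it. *)
Lemma pushforward_lebesgue (R : realType) (phi : R -> R) :
  measurable_fun setT phi ->
  exists2 nu : {measure set (measurableTypeR R) -> \bar R},
    forall A : set (measurableTypeR R), nu A = lebesgue_measure (phi @^-1` A) &
    forall f : R -> \bar R, measurable_fun setT f -> (forall t, 0 <= f t)%E ->
      (\int[nu]_t f t = \int[lebesgue_measure]_t f (phi t))%E.
Proof.
move=> mphi.
exists (measure_function_pushforward__canonical__measure_function_Measure
  (@lebesgue_measure R)
  (mphi : @measurable_fun _ _ (measurableTypeR R) (measurableTypeR R) setT phi)).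
  by [].
move=> f mf f0.
have := @ge0_integral_pushforward _ _ (measurableTypeR R) (measurableTypeR R) R
  _ mphi (@lebesgue_measure R) setT f measurableT mf (fun y _ => f0 y).
by rewrite preimage_setT.
Qed.

(** The image of Lebesgue measure under multiplication by c, multiplied by c, gives
    each interval its length, hence is Lebesgue measure again. *)
Lemma ge0_integral_scale (R : realType) (c : R) (f : R -> \bar R) : 0 < c ->
  measurable_fun [set: R] f -> (forall t, 0 <= f t)%E ->
  (\int[lebesgue_measure]_t f t = c%:E * \int[lebesgue_measure]_t f (c * t)%R)%E.
Proof.
move=> c0 mf f0.
have [nu nuE nu_int] := pushforward_lebesgue (mulrl_measurable c).
rewrite -nu_int// -(@ge0_integral_mscale _ _ _ nu _ measurableT (NngNum (ltW c0)) f)//.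
apply: eq_measure_integral => A mA _.
apply: lebesgue_measure_unique => // _ [[a b]] _ <-.
transitivity (c%:E * nu `]a, b]%classic)%E; last by [].
rewrite nuE.
have -> : ( *%R c) @^-1` `]a, b]%classic = `](a / c), (b / c)]%classic.
  apply/seteqP; split => x /=; rewrite !in_itv/= ltr_pdivrMr// ler_pdivlMr//;
  by rewrite [x * c]mulrC.
rewrite /= !lebesgue_measure_itv/= !lte_fin ltr_pM2r ?invr_gt0//.
case: ifP => _; last by rewrite mule0.
by rewrite -!EFinB -EFinM -mulrBl mulrCA divff ?mulr1 ?gt_eqF.
Qed.

(** Integrals below run over the whole line, where scaling and Tonelli apply without
    side conditions on the domain; the fundamental theorem gives them on half-lines. *)
Lemma integral_itvE (R : realType) (a : itv_bound R) (b : itv_bound R) (f : R -> R) :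
  (\int[lebesgue_measure]_(t in [set` Interval a b]) (f t)%:E =
   \int[lebesgue_measure]_t (if t \in Interval a b then f t else 0)%:E)%E.
Proof.
rewrite integral_mkcond; apply: eq_integral => t _.
by rewrite patchE mem_setE; case: ifP.
Qed.

(** The fundamental theorem on a half-line, with the hypotheses in pointwise form. *)
Lemma ge0_integral_derivative (R : realType) (f F : R -> R) (a l v : R) :
  v = l - F a ->
  (forall x, a <= x -> 0 <= f x) ->
  (forall x, a <= x -> is_derive x 1 F (f x)) ->
  (forall x, a <= x -> {for x, continuous f}) ->
  F x @[x --> +oo] --> l ->
  (\int[lebesgue_measure]_(x in `[a, +oo[) (f x)%:E = v%:E)%E.
Proof.
move=> -> f0 dF cf Fl; rewrite EFinB; apply: ge0_continuous_FTC2y => //.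
- apply: continuous_in_subspaceT => x; rewrite inE/= in_itv/= andbT.
  exact: cf.
- by move=> x ax; have [] := dF x (ltW ax).
- apply: cvg_at_right_filter.
  apply: differentiable_continuous; apply/derivable1_diffP.
  by have [] := dF a (lexx _).
- move=> x; rewrite in_itv/= andbT => ax; rewrite derive1E.
  by have [] := dF x (ltW ax).
Qed.

Lemma integral_expR_tail (R : realType) (c a : R) : 0 < c ->
  (\int[lebesgue_measure]_(s in `[a, +oo[) (c * expR (- (c * s)))%:E
   = (expR (- (c * a)))%:E)%E.
Proof.
move=> c0.
apply: (ge0_integral_derivative (F := fun s => - expR (- (c * s))) (l := 0)).
- by rewrite sub0r opprK.
- by move=> x _; rewrite mulr_ge0 ?ltW ?expR_gt0.
- move=> x _; apply: is_derive_eq.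
  by rewrite /GRing.scale/=; ring.
- move=> x _; apply: cvgM; first exact: cvg_cst.
  apply: continuous_comp; last exact: continuous_expR.
  by apply: cvgN; apply: cvgM; [exact: cvg_cst|exact: cvg_id].
- rewrite -oppr0; apply: cvgN.
  apply: (@cvg_comp _ _ _ (fun s => c * s) (fun z => expR (- z)) _
    (pinfty_nbhs R)); last exact: cvgr_expR.
  exact: gt0_cvgMry.
Qed.

Lemma powR_cvgy0 (R : realType) (a : R) : 0 < a ->
  s `^ (- a) @[s --> +oo] --> 0.
Proof.
move=> a0; apply/cvgrPdist_le => e e0; near=> s.
have s0 : 0 < s by near: s; exact: nbhs_pinfty_gt.
rewrite sub0r normrN ger0_norm ?powR_ge0// powRN.
have es : e `^ (- a^-1) <= s by near: s; exact: nbhs_pinfty_ge.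
rewrite -[leRHS]invrK lef_pV2 ?posrE ?invr_gt0 ?powR_gt0//.
apply: le_trans (ge0_ler_powR (ltW a0) _ _ es); rewrite ?nnegrE ?powR_ge0 ?(ltW s0)//.
by rewrite -powRrM mulNr mulVf ?gt_eqF// powRN powRr1 ?(ltW e0).
Unshelve. all: by end_near. Qed.

Lemma integral_powR_tail (R : realType) (a : R) : 0 < a ->
  (\int[lebesgue_measure]_(s in `[1%R, +oo[) (s `^ (- a - 1))%:E = (a^-1)%:E)%E.
Proof.
move=> a0.
have dp (b x : R) : 1 <= x -> is_derive x 1 (fun s => s `^ b) (b * x `^ (b - 1)).
  by move=> x1; apply: is_derive1_powR; rewrite (lt_le_trans _ x1).
apply: (ge0_integral_derivative (F := fun s => - a^-1 * s `^ (- a)) (l := 0)).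
- by rewrite powR1 mulr1 sub0r opprK.
- by move=> x _; exact: powR_ge0.
- move=> x x1; have := dp (- a) x x1 => ?; apply: is_derive_eq.
  by rewrite /GRing.scale/= mulrA mulrNN mulVf ?gt_eqF// mul1r.
- move=> x x1; apply: differentiable_continuous; apply/derivable1_diffP.
  by have [] := dp (- a - 1) x x1.
- rewrite -(mulr0 (- a^-1)); apply: cvgM; first exact: cvg_cst.
  exact: powR_cvgy0.
Qed.

(** * Laplace transforms and the Gamma function *)

(** For x > 0 the inverse is the power with exponent -1, whose measurability is
    known; the value 0 at 0 fits the second branch. *)
Lemma measurable_inv (R : realType) : measurable_fun setT (fun x : R => x^-1).
Proof.
have -> : (fun x : R => x^-1) =
    (fun x => if 0 < x then x `^ (-1) else - ((- x) `^ (-1))).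
  apply/funext => x; case: ltP => x0; first by rewrite powR_inv1// ltW.
  by rewrite powR_inv1 ?oppr_ge0// invrN opprK.
apply: measurable_fun_ifT.
- exact: (measurable_fun_ltr (f := fun=> 0) (g := id)).
- exact: measurable_powR.
- apply: measurable_funN.
  by apply: (measurableT_comp (f := fun s : R => s `^ (-1))); first exact: measurable_powR.
Qed.

(** The cases for the order relations, sums and products applied to one argument are
    needed because unification eta-reduces functions such as fun t => 0 < t. *)
Ltac measurability := repeat match goal with
  | H : measurable_fun _ ?f |- measurable_fun _ ?f => exact: H
  | |- measurable_fun _ (fun z => z) => exact: measurable_id
  | |- measurable_fun _ (fun z => z.1) => exact: measurable_fst
  | |- measurable_fun _ (fun z => z.2) => exact: measurable_snd
  | |- measurable_fun _ fst => exact: measurable_fst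
  | |- measurable_fun _ snd => exact: measurable_snd
  | |- measurable_fun _ (fun z => ?c) => exact: measurable_cst
  | |- measurable_fun _ (fun z => (@?f z)%:E) => apply/measurable_EFinP
  | |- measurable_fun _ (Order.lt ?c) =>
         apply: (measurable_fun_ltr (f := fun=> c) (g := id))
  | |- measurable_fun _ (Order.le ?c) =>
         apply: (measurable_fun_ler (f := fun=> c) (g := id))
  | |- measurable_fun _ ( *%R ?c) =>
         apply: (measurable_funM (f := fun=> c) (g := id))
  | |- measurable_fun _ (+%R ?c) =>
         apply: (measurable_funD (f := fun=> c) (g := id))
  | |- measurable_fun _ id => exact: measurable_id
  | |- measurable_fun _ (fun z => @?f z && @?g z) => apply: measurable_and
  | |- measurable_fun _ (fun z => (@?f z < @?g z)%R) => apply: measurable_fun_ltr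
  | |- measurable_fun _ (fun z => (@?f z <= @?g z)%R) => apply: measurable_fun_ler
  | |- measurable_fun _ (fun z => @?f z * @?g z) => apply: measurable_funM
  | |- measurable_fun _ (fun z => @?f z - @?g z) => apply: measurable_funB
  | |- measurable_fun _ (fun z => @?f z + @?g z) => apply: measurable_funD
  | |- measurable_fun _ (fun z => - @?f z) => apply: measurable_funN
  | |- measurable_fun _ (fun z => Num.max (@?f z) (@?g z)) => apply: measurable_maxr
  | |- measurable_fun _ (fun z => expR (@?f z)) =>
         apply: (measurableT_comp (f := expR)); first exact: measurable_expR
  | |- measurable_fun _ (fun z => (@?f z) `^ ?p) =>
         apply: (measurableT_comp (f := fun s => s `^ p)); first exact: measurable_powR
  | |- measurable_fun _ (fun z => (@?f z)^-1) =>
         apply: (measurableT_comp (@measurable_inv _))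
  | H : measurable_fun setT ?k |- measurable_fun _ (fun z => ?k (@?f z)) =>
         apply: (measurableT_comp (f := k)); first exact: H
  | |- measurable_fun _ _ => apply: measurable_fun_ifT
  end.

Lemma lebesgue_integralZl (R : realType) (c : R) (f : R -> R) : 0 <= c ->
  measurable_fun setT f -> (forall t, 0 <= f t) ->
  (\int[lebesgue_measure]_t (c * f t)%:E =
   c%:E * \int[lebesgue_measure]_t (f t)%:E)%E.
Proof.
move=> c0 mf f0.
apply: (@ge0_integralZl _ _ R lebesgue_measure setT measurableT
  (fun t => (f t)%:E) _ c%:E) => //.
- by measurability.
- by move=> t _; rewrite lee_fin.
Qed.

Lemma lebesgue_tonelli (R : realType) (f : R -> R -> R) :
  measurable_fun setT (fun z : R * R => f z.1 z.2) -> (forall s t, 0 <= f s t) ->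
  (\int[lebesgue_measure]_s \int[lebesgue_measure]_t (f s t)%:E =
   \int[lebesgue_measure]_t \int[lebesgue_measure]_s (f s t)%:E)%E.
Proof.
move=> mf f0.
apply: (fubini_tonelli (m1 := lebesgue_measure) (m2 := lebesgue_measure)
  (fun z => (f z.1 z.2)%:E)).
- by measurability.
- by move=> z; rewrite lee_fin.
Qed.

(** Vanishes for t <= 0, so that integrals over (0, oo) can be written over the whole
    line. *)
Definition pow_density (R : realType) (a t : R) : R :=
  if 0 < t then t `^ (a - 1) else 0.

Lemma measurable_pow_density (R : realType) (a : R) :
  measurable_fun setT (pow_density a).
Proof. by rewrite /pow_density; measurability. Qed.

Lemma pow_density_ge0 (R : realType) (a t : R) : 0 <= pow_density a t.
Proof. by rewrite /pow_density; case: ifP => //; rewrite powR_ge0. Qed.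

Lemma mul_pow_density (R : realType) (a t : R) :
  t * pow_density a t = pow_density (a + 1) t.
Proof.
rewrite /pow_density; case: ifP => [t0|_]; last by rewrite mulr0.
rewrite addrK -{1}(powRr1 (ltW t0)) -powRD ?(gt_eqF t0) ?implybT//.
by congr powR; ring.
Qed.

(** Two-sided, but only applied to functions that vanish for t <= 0; with values in the
    extended reals the identities below hold without integrability hypotheses. *)
Definition laplace (R : realType) (k : R -> R) (x : R) : \bar R :=
  (\int[lebesgue_measure]_t (k t * expR (- (x * t)))%:E)%E.

Lemma laplace_ge0 (R : realType) (k : R -> R) (x : R) :
  (forall t, 0 <= k t) -> (0 <= laplace k x)%E.
Proof.
by move=> k0; apply: integral_ge0 => t _; rewrite lee_fin mulr_ge0 ?expR_ge0.
Qed.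

Lemma laplace_le (R : realType) (k1 k2 : R -> R) (x : R) :
  measurable_fun setT k1 -> measurable_fun setT k2 ->
  (forall t, 0 <= k1 t <= k2 t) -> (laplace k1 x <= laplace k2 x)%E.
Proof.
move=> mk1 mk2 k12; apply: ge0_le_integral => //.
- by move=> t _; rewrite lee_fin mulr_ge0 ?expR_ge0//; case/andP: (k12 t).
- by measurability.
- by measurability.
- by move=> t _; rewrite lee_fin ler_wpM2r ?expR_ge0//; case/andP: (k12 t).
Qed.

Lemma laplaceD (R : realType) (k1 k2 : R -> R) (x : R) :
  measurable_fun setT k1 -> measurable_fun setT k2 ->
  (forall t, 0 <= k1 t) -> (forall t, 0 <= k2 t) ->
  laplace (fun t => k1 t + k2 t) x = (laplace k1 x + laplace k2 x)%E.
Proof.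
move=> mk1 mk2 k10 k20; rewrite /laplace -ge0_integralD//.
- by apply: eq_integral => t _; rewrite mulrDl.
- by move=> t _; rewrite lee_fin mulr_ge0 ?expR_ge0.
- by measurability.
- by move=> t _; rewrite lee_fin mulr_ge0 ?expR_ge0.
- by measurability.
Qed.

Lemma laplaceZ (R : realType) (c : R) (k : R -> R) (x : R) : 0 <= c ->
  measurable_fun setT k -> (forall t, 0 <= k t) ->
  laplace (fun t => c * k t) x = (c%:E * laplace k x)%E.
Proof.
move=> c0 mk k0; rewrite /laplace.
rewrite -(@lebesgue_integralZl R c (fun t => k t * expR (- (x * t))))//.
- by apply: eq_integral => t _; rewrite -mulrA.
- by measurability.
- by move=> t; rewrite mulr_ge0 ?expR_ge0.
Qed.

Lemma laplace_pow_scale (R : realType) (a x : R) : 0 < x ->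
  laplace (pow_density a) x = ((x `^ (- a))%:E * laplace (pow_density a) 1)%E.
Proof.
move=> x0; have mp := measurable_pow_density a.
have p0 := pow_density_ge0 a.
pose g t := pow_density a (x^-1 * t) * expR (- (x * (x^-1 * t))).
apply: (etrans (@ge0_integral_scale R x^-1
  (fun t => (pow_density a t * expR (- (x * t)))%:E) _ _ _)).
- by rewrite invr_gt0.
- by measurability.
- by move=> t; rewrite lee_fin mulr_ge0 ?expR_ge0.
apply: (etrans (esym (@lebesgue_integralZl R x^-1 g _ _ _))).
- by rewrite invr_ge0 ltW.
- by rewrite /g; measurability.
- by move=> t; rewrite mulr_ge0 ?expR_ge0.
apply: (etrans _ (@lebesgue_integralZl R _
  (fun t => pow_density a t * expR (- (1 * t))) _ _ _)); last 3 first.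
- exact: powR_ge0.
- by measurability.
- by move=> t; rewrite mulr_ge0 ?expR_ge0.
apply: eq_integral => t _; congr (_%:E); rewrite /g.
rewrite mulVKf ?gt_eqF// mul1r !mulrA; congr (_ * _).
rewrite /pow_density pmulr_rgt0 ?invr_gt0//.
case: ifP => [t0|_]; last by rewrite !mulr0.
rewrite powRM ?invr_ge0 ?ltW// mulrA; congr (_ * _).
rewrite -powR_inv1 ?ltW// -powRrM -powRD ?(gt_eqF x0) ?implybT//.
by congr powR; ring.
Qed.

Lemma expR_tail_density (R : realType) (t : R) : 0 < t ->
  (\int[lebesgue_measure]_s (if (1 <= s)%R then t * expR (- (t * s)) else 0)%:E
   = (expR (- t))%:E)%E.
Proof.
move=> t0; rewrite -[in RHS](mulr1 t) -integral_expR_tail// integral_itvE.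
by apply: eq_integral => s _; rewrite in_itv/= andbT.
Qed.

(** Tonelli applied to t^a e^{-ts} on s >= 1: integrating in s first gives t^{a-1}
    e^{-t}, integrating in t first gives Gamma(a+1) s^{-a-1}.  As an identity in
    the extended reals it also transports finiteness from a + 1 down to a, which
    settles the singularity at 0 when a < 1. *)
Lemma laplace_pow_rec (R : realType) (a : R) : 0 < a ->
  (laplace (pow_density (a + 1)) 1 = a%:E * laplace (pow_density a) 1)%E.
Proof.
move=> a0.
suff -> : (laplace (pow_density a) 1 = (a^-1)%:E * laplace (pow_density (a + 1)) 1)%E.
  by rewrite muleA -EFinM divff ?gt_eqF// mul1e.
have mp := measurable_pow_density a.
have mp1 := measurable_pow_density (a + 1).
have p0 := pow_density_ge0 a.
pose f (t s : R) : R := pow_density a t *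
  (if 1 <= s then t * expR (- (t * s)) else 0).
have fE t s : f t s = if 1 <= s then pow_density (a + 1) t * expR (- (s * t)) else 0.
  rewrite /f -mul_pow_density [s * t]mulrC; case: ifP => _; last by rewrite mulr0.
  by ring.
have f0 t s : 0 <= f t s.
  by rewrite fE; case: ifP => // _; rewrite mulr_ge0 ?expR_ge0 ?pow_density_ge0.
have mf : measurable_fun setT (fun z : R * R => f z.1 z.2).
  by rewrite /f; measurability.
transitivity (\int[lebesgue_measure]_t \int[lebesgue_measure]_s (f t s)%:E)%E.
  apply: eq_integral => t _; rewrite mul1r EFinM.
  have [t0|t0] := ltP 0 t; last first.
    rewrite /pow_density ltNge t0/= mul0e integral0_eq// => s _.
    by rewrite /f /pow_density ltNge t0/= mul0r.
  rewrite -expR_tail_density//.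
  apply: esym; apply: (@lebesgue_integralZl R (pow_density a t)) => //.
  - by measurability.
  - by move=> s; case: ifP => // _; rewrite mulr_ge0 ?expR_ge0 ?ltW.
rewrite lebesgue_tonelli//.
transitivity (\int[lebesgue_measure]_s ((if 1%R <= s then s `^ (- a - 1) else 0)%:E *
    laplace (pow_density (a + 1)) 1))%E.
  apply: eq_integral => s _; under eq_integral do rewrite fE.
  case: ifP => [s1|_]; last by rewrite mul0e integral0_eq.
  rewrite -[LHS]/(laplace (pow_density (a + 1)) s).
  by rewrite laplace_pow_scale ?opprD// (lt_le_trans _ s1).
rewrite ge0_integralZr//.
- congr (_ * _)%E; rewrite -integral_powR_tail// integral_itvE.
  by apply: eq_integral => s _; rewrite in_itv/= andbT.
- by measurability.
- by move=> s _; rewrite lee_fin; case: ifP => // _; exact: powR_ge0.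
- by apply: laplace_ge0; exact: pow_density_ge0.
Qed.

Lemma laplace_pow1 (R : realType) : laplace (pow_density 1) 1 = 1%:E :> \bar R.
Proof.
have -> : 1 = expR (- (1 * 0)) :> R by rewrite mulr0 oppr0 expR0.
apply: (etrans _ (integral_expR_tail 0 ltr01)).
apply: (etrans _ (@integral_itv_obnd_cbnd _ _ (BInfty _ false) _ _)); last by measurability.
rewrite integral_itvE; apply: eq_integral => t _; congr (_%:E).
rewrite mulr0 oppr0 expR0 in_itv/= andbT /pow_density subrr powRr0.
by case: ifP => _; rewrite ?mul0r.
Qed.

(** The middle power is below the upper one on t >= 1 and below the lower one on
    t <= 1.  This transfers finiteness and positivity of Gamma from the factorials to
    all exponents. *)
Lemma pow_density_between (R : realType) (a b c t : R) : a <= b <= c ->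
  pow_density b t <= pow_density a t + pow_density c t.
Proof.
case/andP => ab bc; rewrite /pow_density; case: ifP => [t0|_]; last by rewrite addr0.
have [t1|t1] := leP 1 t.
  by rewrite (le_trans (ler_powR t1 (lerB bc (lexx 1))))// lerDr powR_ge0.
have t01 : 0 < t <= 1 by rewrite t0 ltW.
by rewrite (le_trans (ger_powR t01 (lerB ab (lexx 1))))// lerDl powR_ge0.
Qed.

Lemma laplace_pow_nat (R : realType) (n : nat) :
  laplace (pow_density n.+1%:R) 1 = (n`!%:R)%:E :> \bar R.
Proof.
elim: n => [|n IH]; first by rewrite laplace_pow1.
by rewrite -natr1 laplace_pow_rec ?ltr0Sn// IH -EFinM factS natrM.
Qed.

Lemma laplace_pow_between (R : realType) (a b c x : R) : a <= b <= c ->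
  (laplace (pow_density b) x <= laplace (pow_density a) x + laplace (pow_density c) x)%E.
Proof.
have ma := measurable_pow_density a; have mb := measurable_pow_density b.
have mc := measurable_pow_density c.
move=> abc; rewrite -laplaceD//; try exact: pow_density_ge0.
apply: laplace_le => //; first by measurability.
by move=> t; rewrite pow_density_ge0 pow_density_between.
Qed.

Lemma laplace_pow_lty (R : realType) (a : R) : 0 < a ->
  (laplace (pow_density a) 1 < +oo)%E.
Proof.
(* Large exponents lie between 1 and an integer; the others follow by the
   functional equation. *)
have large (b : R) : 1 <= b -> (laplace (pow_density b) 1 < +oo)%E.
  move=> b1; have [N Nb] : exists N, b <= N.+1%:R.
    exists (Num.Def.archi_bound b); apply/ltW.
    by apply: lt_trans (archi_boundP (le_trans ler01 b1)) _; rewrite ltr_nat.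
  apply: le_lt_trans (laplace_pow_between (a := 1) (c := N.+1%:R) 1 _) _.
    by rewrite b1 Nb.
  by rewrite laplace_pow1 laplace_pow_nat -EFinD ltry.
move=> a0; have := large (a + 1); rewrite lerDr => /(_ (ltW a0)).
rewrite laplace_pow_rec//; move: (laplace_ge0 1 (pow_density_ge0 a)).
case: (laplace (pow_density a) 1) => [r _ _|_|//]; first exact: ltry.
by rewrite gt0_muley ?lte_fin.
Qed.

(** If Gamma(a) = 0 then Gamma(a+N) = 0 for all N by the functional equation, and an
    integer between a and a + N would have Gamma equal to 0. *)
Lemma laplace_pow_gt0 (R : realType) (a : R) : 0 < a ->
  (0 < laplace (pow_density a) 1)%E.
Proof.
move=> a0; rewrite lt0e laplace_ge0 ?andbT; last exact: pow_density_ge0.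
apply/negP => /eqP La0.
have Lan n : laplace (pow_density (a + n%:R)) 1 = 0%E.
  elim: n => [|n IH]; first by rewrite addr0.
  by rewrite -natr1 addrA laplace_pow_rec ?IH ?mule0// ltr_wpDr.
have [N aN] : exists N, a <= N.+1%:R.
  exists (Num.Def.archi_bound a); apply/ltW.
  by apply: lt_trans (archi_boundP (ltW a0)) _; rewrite ltr_nat.
have := @laplace_pow_between R a N.+1%:R (a + N.+1%:R) 1.
rewrite aN lerDr (ltW a0) => /(_ isT).
by rewrite laplace_pow_nat La0 Lan adde0 lee_fin leNgt ltr0n fact_gt0.
Qed.

Definition euler_gamma (R : realType) (a : R) : R :=
  fine (laplace (pow_density a) 1).

Lemma euler_gammaE (R : realType) (a : R) : 0 < a ->
  laplace (pow_density a) 1 = (euler_gamma a)%:E.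
Proof.
move=> a0; rewrite fineK// ge0_fin_numE ?laplace_pow_lty// laplace_ge0//.
exact: pow_density_ge0.
Qed.

Lemma euler_gamma_gt0 (R : realType) (a : R) : 0 < a -> 0 < euler_gamma a.
Proof. by move=> a0; rewrite -lte_fin -euler_gammaE// laplace_pow_gt0. Qed.

Lemma euler_gammaS (R : realType) (a : R) : 0 < a ->
  euler_gamma (a + 1) = a * euler_gamma a.
Proof.
move=> a0; have a10 : 0 < a + 1 by rewrite ltr_wpDr.
by have := laplace_pow_rec a0; rewrite (euler_gammaE a0) (euler_gammaE a10) => -[].
Qed.

Lemma laplace_pow (R : realType) (a x : R) : 0 < a -> 0 < x ->
  laplace (pow_density a) x = (euler_gamma a * x `^ (- a))%:E.
Proof. by move=> a0 x0; rewrite laplace_pow_scale// euler_gammaE// -EFinM mulrC. Qed.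

(** * Functions with a nonnegative Laplace density *)

Definition laplace_representable (R : realType) (f : R -> R) : Prop :=
  exists k : R -> R, [/\ measurable_fun setT k, forall t, 0 <= k t,
    forall t : R, t <= 0 -> k t = 0 & forall x : R, 0 < x -> laplace k x = (f x)%:E].

Lemma laplace_representable_ext (R : realType) (f g : R -> R) :
  (forall x : R, 0 < x -> f x = g x) ->
  laplace_representable f -> laplace_representable g.
Proof.
by move=> fg [k [mk k0 ks kf]]; exists k; split=> // x x0; rewrite kf ?fg.
Qed.

Lemma laplace_representable0 (R : realType) :
  laplace_representable (fun=> 0 : R).
Proof.
exists (fun=> 0); split => // x _.
by rewrite /laplace integral0_eq// => t _; rewrite mul0r.
Qed.

Lemma laplace_representableD (R : realType) (f g : R -> R) :
  laplace_representable f -> laplace_representable g ->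
  laplace_representable (fun x => f x + g x).
Proof.
move=> [k [mk k0 ks kf]] [l [ml l0 ls lg]].
exists (fun t => k t + l t); split.
- by measurability.
- by move=> t; rewrite addr_ge0.
- by move=> t t0; rewrite ks// ls// addr0.
- by move=> x x0; rewrite laplaceD// kf// lg// EFinD.
Qed.

Lemma laplace_representableZ (R : realType) (c : R) (f : R -> R) : 0 <= c ->
  laplace_representable f -> laplace_representable (fun x => c * f x).
Proof.
move=> c0 [k [mk k0 ks kf]]; exists (fun t => c * k t); split.
- by measurability.
- by move=> t; rewrite mulr_ge0.
- by move=> t t0; rewrite ks// mulr0.
- by move=> x x0; rewrite laplaceZ// kf// EFinM.
Qed.

Lemma laplace_representable_ge0 (R : realType) (f : R -> R) (x : R) :
  laplace_representable f -> 0 < x -> 0 <= f x.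
Proof. by move=> [k [mk k0 _ kf]] x0; rewrite -lee_fin -kf// laplace_ge0. Qed.

(** The density is nonnegative, so a vanishing transform forces it to vanish almost
    everywhere. *)
Lemma laplace_representable_vanish (R : realType) (f : R -> R) (x y : R) :
  laplace_representable f -> 0 < x -> 0 < y -> f x = 0 -> f y = 0.
Proof.
move=> [k [mk k0 ks kf]] x0 y0 fx0; apply: EFin_inj; rewrite -kf//.
have e0 t : 0 <= k t * expR (- (x * t)) by rewrite mulr_ge0 ?expR_ge0.
have mx (z : R) : measurable_fun setT (fun t => (k t * expR (- (z * t)))%:E).
  by measurability.
have [ae0 _] := @ae_eq_integral_abs _ _ R lebesgue_measure setT measurableT _ (mx x).
apply: (@etrans _ _ (\int[lebesgue_measure]_t (cst 0 t))%E); last exact: integral0.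
apply: ge0_ae_eq_integral => //.
- exact: mx.
- by move=> t _; rewrite lee_fin mulr_ge0 ?expR_ge0.
- have : (\int[lebesgue_measure]_t `|(k t * expR (- (x * t)))%:E| = 0)%E.
    rewrite -[RHS]/(0%:E) -fx0 -kf//; apply: eq_integral => t _.
    by rewrite gee0_abs// lee_fin.
  move=> /ae0; apply: filterS => t /= /(_ I)[/eqP].
  rewrite mulf_eq0 (gt_eqF (expR_gt0 _)) orbF => /eqP kt0 _.
  by rewrite kt0 mul0r.
Qed.

(** The densities may be infinite on a null set, where the real density chosen
    below takes an arbitrary nonnegative value: product densities are integrals
    that are only finite almost everywhere. *)
Lemma laplace_representableB (R : realType) (f g : R -> R) (K L : R -> \bar R) :
  measurable_fun setT K -> measurable_fun setT L ->
  (forall t, 0 <= L t <= K t)%E -> (forall t : R, t <= 0 -> K t = 0%E) ->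
  (forall x : R, (0 < x)%R ->
    \int[lebesgue_measure]_t (K t * (expR (- (x * t)))%:E) = (f x)%:E)%E ->
  (forall x : R, (0 < x)%R ->
    \int[lebesgue_measure]_t (L t * (expR (- (x * t)))%:E) = (g x)%:E)%E ->
  laplace_representable (fun x => f x - g x).
Proof.
move=> mK mL LK Ks Kf Lg.
have L0 t : (0 <= L t)%E by case/andP: (LK t).
have K0 t : (0 <= K t)%E by case/andP: (LK t) => L0' /(le_trans L0').
pose k t := Num.max (fine (K t) - fine (L t)) 0.
have mfine : measurable_fun setT (@fine R) by exact: fine_measurable.
have mk : measurable_fun setT k by rewrite /k; measurability.
have me (x : R) : measurable_fun setT (fun t : R => (expR (- (x * t)))%:E).
  by measurability.
exists k; split => //.
- by move=> t; rewrite le_max lexx orbT.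
- move=> t t0; have := LK t; rewrite /k Ks// -eq_le => /eqP ->.
  by rewrite subrr maxxx.
move=> x x0.
have mKe : measurable_fun setT (fun t : R => K t * (expR (- (x * t)))%:E)%E.
  exact: emeasurable_funM.
have mLe : measurable_fun setT (fun t : R => L t * (expR (- (x * t)))%:E)%E.
  exact: emeasurable_funM.
have finK : lebesgue_measure.-integrable setT
    (fun t : R => K t * (expR (- (x * t)))%:E)%E.
  apply/integrableP; split => //.
  rewrite (_ : (\int[_]_t _ = (f x)%:E)%E) ?ltry// -Kf//.
  by apply: eq_integral => t _; rewrite gee0_abs// mule_ge0// lee_fin expR_ge0.
have : (laplace k x + \int[lebesgue_measure]_t (L t * (expR (- (x * t)))%:E) =
        \int[lebesgue_measure]_t (K t * (expR (- (x * t)))%:E))%E.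
  have k0 t : 0 <= k t by rewrite le_max lexx orbT.
  have ke0 t : (0 <= (k t * expR (- (x * t)))%:E)%E.
    by rewrite lee_fin mulr_ge0 ?expR_ge0.
  have Le0 t : (0 <= L t * (expR (- (x * t)))%:E)%E.
    by rewrite mule_ge0// lee_fin expR_ge0.
  have mke : measurable_fun setT (fun t : R => (k t * expR (- (x * t)))%:E).
    by measurability.
  rewrite /laplace -ge0_integralD//.
  apply: ge0_ae_eq_integral => //.
  - exact: emeasurable_funD.
  - by move=> t _; rewrite adde_ge0.
  - by move=> t _; rewrite mule_ge0// lee_fin expR_ge0.
  have := integrable_ae measurableT finK; apply: filterS => t /(_ I) Kfin _.
  have {}Kfin : K t \is a fin_num.
    move: Kfin (K0 t); case: (K t) => //; rewrite gt0_mulye ?lte_fin ?expR_gt0//.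
  have Lfin : L t \is a fin_num.
    rewrite ge0_fin_numE//; case/andP: (LK t) => _ /le_lt_trans; apply.
    by rewrite -ge0_fin_numE.
  rewrite /k -(fineK Kfin) -(fineK Lfin) -!EFinM -EFinD -mulrDl; congr ((_ * _)%:E).
  rewrite max_l/= ?subrK// subr_ge0 fine_le//.
  by case/andP: (LK t).
rewrite Kf// Lg//; case: (laplace k x) => //= r.
by rewrite -EFinD => -[<-]; rewrite addrK.
Qed.

(** * Representable functions are completely monotonic *)

(** Half of the exponential absorbs the factor t, since s <= e^s at s = at/2. *)
Lemma laplace_moment_le (R : realType) (k : R -> R) (a t : R) : 0 < a ->
  (forall t : R, 0 <= k t) -> (forall t : R, t <= 0 -> k t = 0) ->
  t * k t * expR (- (a * t)) <= (2 / a) * (k t * expR (- (a / 2 * t))).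
Proof.
move=> a0 k0 ks; have [t0|t0] := leP t 0.
  by rewrite ks// !(mulr0, mul0r).
have -> : expR (- (a * t)) = expR (- (a / 2 * t)) * expR (- (a / 2 * t)).
  by rewrite -expRD; congr expR; field.
have -> : t * k t * (expR (- (a / 2 * t)) * expR (- (a / 2 * t))) =
   (t * expR (- (a / 2 * t))) * (k t * expR (- (a / 2 * t))) by ring.
apply: ler_wpM2r; first by rewrite mulr_ge0 ?expR_ge0.
rewrite expRN ler_pdivrMr ?expR_gt0//.
rewrite -ler_pdivrMl ?divr_gt0// invf_div.
by apply: le_trans (expR_ge1Dx _); rewrite lerDr.
Qed.

Lemma laplace_moment_lty (R : realType) (k : R -> R) (a : R) : 0 < a ->
  measurable_fun setT k ->
  (forall t : R, 0 <= k t) -> (forall t : R, t <= 0 -> k t = 0) ->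
  (laplace k (a / 2) < +oo)%E -> (laplace (fun t : R => (t * k t)%R) a < +oo)%E.
Proof.
move=> a0 mk k0 ks fin.
apply: (@le_lt_trans _ _ ((2 / a)%:E * laplace k (a / 2))%E); last first.
  by rewrite lte_mul_pinfty ?lee_fin ?divr_ge0 ?(ltW a0).
rewrite /laplace -(@lebesgue_integralZl R (2 / a)
  (fun t => k t * expR (- (a / 2 * t)))) ?divr_ge0 ?(ltW a0)//; last 2 first.
- by measurability.
- by move=> t; rewrite mulr_ge0 ?expR_ge0.
apply: ge0_le_integral => //.
- move=> t _; rewrite lee_fin mulr_ge0 ?expR_ge0//.
  have [t0|t0] := leP t 0; first by rewrite ks// mulr0.
  by rewrite mulr_ge0 ?(ltW t0).
- by measurability.
- by measurability.
- by move=> t _; rewrite lee_fin laplace_moment_le.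
Qed.

(** Differentiation under the integral sign; on x > a/2 the derivative of the
    integrand is dominated by its value at a/2.  Minus the derivative has density
    t k(t), so the class is stable and all derivatives follow by induction. *)
Lemma laplace_representable_derive (R : realType) (f : R -> R) :
  laplace_representable f -> exists2 g : R -> R, laplace_representable g &
    forall x : R, 0 < x -> is_derive x 1 f (- g x).
Proof.
move=> [k [mk k0 ks kf]].
have kf_fin (x : R) : 0 < x -> (laplace k x < +oo)%E by move=> /kf ->; rewrite ltry.
have tk0 t : 0 <= t * k t.
  have [t0|t0] := leP t 0; first by rewrite ks// mulr0.
  by rewrite mulr_ge0 ?(ltW t0).
have mtk : measurable_fun setT (fun t : R => t * k t) by measurability.
have tk_fin (x : R) : 0 < x -> (laplace (fun t : R => (t * k t)%R) x < +oo)%E.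
  by move=> x0; apply: laplace_moment_lty => //; apply: kf_fin; rewrite divr_gt0.
have kint (h : R -> R) (x : R) : measurable_fun setT h -> (forall t, 0 <= h t) ->
    (laplace h x < +oo)%E ->
    lebesgue_measure.-integrable setT (fun t => (h t * expR (- (x * t)))%:E).
  move=> mh h0 hfin; apply/integrableP; split; first by measurability.
  rewrite (_ : (\int[_]_t _ = laplace h x)%E)//.
  by apply: eq_integral => t _; rewrite gee0_abs// lee_fin mulr_ge0 ?expR_ge0.
exists (fun x => fine (laplace (fun t : R => (t * k t)%R) x)).
  exists (fun t => t * k t); split => //.
    by move=> t t0; rewrite ks// mulr0.
  by move=> x x0; rewrite fineK// ge0_fin_numE ?tk_fin// laplace_ge0.
move=> a a0.
pose h (x t : R) := k t * expR (- (x * t)).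
have dh (x t : R) : is_derive x 1 (h ^~ t) (- (t * k t * expR (- (x * t)))).
  by rewrite /h; apply: is_derive_eq; rewrite /GRing.scale/=; ring.
have d1h (x t : R) : partial1of2 h x t = - (t * k t * expR (- (x * t))).
  by rewrite /partial1of2 derive1E; have [] := dh x t.
pose G t := t * k t * expR (- (a / 2 * t)).
have a20 : 0 < a / 2 by rewrite divr_gt0.
have aI : `]a / 2, 2 * a[%classic a.
  by rewrite /= in_itv/=; apply/andP; split; lra.
have hint (x : R) : `]a / 2, 2 * a[%classic x ->
    lebesgue_measure.-integrable setT (EFin \o h x).
  rewrite /= in_itv/= => /andP[x0 _]; apply: kint => //; apply: kf_fin.
  exact: lt_trans x0.
have hder (x t : R) : `]a / 2, 2 * a[%classic x -> [set: R] t ->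
    derivable (h ^~ t) x 1.
  by move=> _ _; have [] := dh x t.
have G0 t : 0 <= G t by rewrite mulr_ge0 ?expR_ge0.
have Gint : lebesgue_measure.-integrable setT (EFin \o G).
  by apply: kint => //; exact: tk_fin.
have Gub (x t : R) : `]a / 2, 2 * a[%classic x -> [set: R] t ->
    `|partial1of2 h x t| <= G t.
  rewrite /= in_itv/= => /andP[x0 _] _; rewrite d1h normrN.
  rewrite ger0_norm /G; last by rewrite mulr_ge0 ?expR_ge0.
  have [t0|t0] := leP t 0; first by rewrite ks// !(mulr0, mul0r).
  by rewrite ler_wpM2l// ler_expR lerN2 ler_pM2r ?(ltW x0).
have der := @derivable_under_integral R _ _ lebesgue_measure h setT measurableT
  a _ _ aI hint hder G G0 Gint Gub.
have val := @differentiation_under_integral R _ _ lebesgue_measure h setT measurableT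
  a _ _ aI hint hder G G0 Gint Gub.
have fE : {near a, (fun x => \int[lebesgue_measure]_(t in setT) h x t) =1 f}.
  near=> x; have x0 : 0 < x by near: x; exact: lt_nbhsr.
  by rewrite /Rintegral -[X in fine X]/(laplace k x) kf.
apply: (near_eq_is_derive fE).
apply: DeriveDef => //; rewrite -derive1E val.
rewrite /Rintegral.
under eq_integral => t _ do rewrite d1h EFinN.
rewrite integral_ge0N; last by move=> t _; rewrite lee_fin mulr_ge0 ?expR_ge0.
by rewrite fineN.
Unshelve. all: by end_near. Qed.

Lemma laplace_representable_derive1n (R : realType) (f : R -> R) (m : nat) :
  laplace_representable f -> exists2 g : R -> R, laplace_representable g &
    forall x, 0 < x -> derive1n m f x = (-1) ^+ m * g x.
Proof.
move=> Lf; elim: m => [|m [g Lg fg]].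
  by exists f => // x _; rewrite expr0 mul1r.
have [h Lh gh] := laplace_representable_derive Lg.
exists h => // x x0; rewrite /= derive1E.
rewrite (@near_eq_derive _ _ _ _ (fun y => (-1) ^+ m * g y)); last first.
  by near=> y; apply: fg; near: y; exact: lt_nbhsr.
have dg := gh x x0.
have -> : 'D_1 (fun y => (-1) ^+ m * g y) x = (-1) ^+ m * 'D_1 g x.
  by rewrite deriveMl//; exact: ex_derive.
by rewrite derive_val exprS; ring.
Unshelve. all: by end_near. Qed.

Lemma laplace_representable_cm (R : realType) (f : R -> R) :
  laplace_representable f -> completely_monotonic `]0, +oo[ f.
Proof.
move=> Lf; split => m x /=; rewrite in_itv/= andbT => x0;
  have [g Lg fg] := laplace_representable_derive1n m Lf.
- have [h _ gh] := laplace_representable_derive Lg.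
  have dg := gh x x0.
  apply: (@near_eq_derivable _ _ _ (fun y => (-1) ^+ m * g y)).
    by near=> y; apply/esym/fg; near: y; exact: lt_nbhsr.
  by apply: derivableM => //; exact: ex_derive.
- rewrite fg// mulrA -exprMn mulrNN mulr1 expr1n mul1r.
  exact: laplace_representable_ge0.
Unshelve. all: by end_near. Qed.

(** * Products of Laplace transforms *)

(** The integrand of the convolution of k and l at t, after the substitution
    u = t/(1+r), w = tr/(1+r), which has Jacobian t/(1+r)^2.  In these coordinates
    powers of t factor out. *)
Definition mult_conv_kernel (R : realType) (k l : R -> R) (t r : R) : R :=
  if (0 < t) && (0 < r)
  then t * (1 + r)^-1 * (1 + r)^-1 * (k (t * (1 + r)^-1) * l (t * (1 + r)^-1 * r))
  else 0.

Lemma mult_conv_kernel_ge0 (R : realType) (k l : R -> R) (t r : R) :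
  (forall t, 0 <= k t) -> (forall t, 0 <= l t) -> 0 <= mult_conv_kernel k l t r.
Proof.
move=> k0 l0; rewrite /mult_conv_kernel; case: ifP => // /andP[t0 r0].
by rewrite !mulr_ge0 ?invr_ge0 ?addr_ge0 ?(ltW t0) ?(ltW r0).
Qed.

Lemma measurable_mult_conv_kernel (R : realType) (k l : R -> R) :
  measurable_fun setT k -> measurable_fun setT l ->
  measurable_fun setT (fun z : R * R => mult_conv_kernel k l z.1 z.2).
Proof. by move=> mk ml; rewrite /mult_conv_kernel; measurability. Qed.

(** Two scalings, w = ur for fixed u and then u = t/(1+r) for fixed r, with an
    exchange of integrals after each. *)
Lemma laplaceM (R : realType) (k l : R -> R) (x : R) :
  measurable_fun setT k -> measurable_fun setT l ->
  (forall t, 0 <= k t) -> (forall t, 0 <= l t) ->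
  (forall t : R, t <= 0 -> k t = 0) -> (forall t : R, t <= 0 -> l t = 0) ->
  (laplace k x * laplace l x = \int[lebesgue_measure]_t
    (\int[lebesgue_measure]_r (mult_conv_kernel k l t r)%:E * (expR (- (x * t)))%:E))%E.
Proof.
move=> mk ml k0 l0 ks ls.
pose mu := @lebesgue_measure R.
(* The Jacobian u of w = ur, cut off at 0 to keep the integrand nonnegative. *)
pose A (u r : R) := if 0 < r then
  Num.max u 0 * (k u * l (u * r)) * expR (- (x * (u * (1 + r)))) else 0.
have A0 u r : 0 <= A u r.
  rewrite /A; case: ifP => // _.
  by rewrite !mulr_ge0 ?expR_ge0// le_max lexx orbT.
have mA : measurable_fun setT (fun z : R * R => A z.1 z.2).
  by rewrite /A; measurability.
pose B (t r : R) := mult_conv_kernel k l t r * expR (- (x * t)).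
have B0 t r : 0 <= B t r by rewrite mulr_ge0 ?expR_ge0 ?mult_conv_kernel_ge0.
have mB : measurable_fun setT (fun z : R * R => B z.1 z.2).
  apply: measurable_funM; first exact: measurable_mult_conv_kernel.
  by measurability.
have kx0 t : 0 <= k t * expR (- (x * t)) by rewrite mulr_ge0 ?expR_ge0.
have lx0 t : 0 <= l t * expR (- (x * t)) by rewrite mulr_ge0 ?expR_ge0.
have mkx : measurable_fun setT (fun t => k t * expR (- (x * t))) by measurability.
have mlx : measurable_fun setT (fun t => l t * expR (- (x * t))) by measurability.
transitivity (\int[mu]_u \int[mu]_r (A u r)%:E)%E.
  rewrite -(@ge0_integralZr _ _ R mu setT measurableT
    (fun u => (k u * expR (- (x * u)))%:E)); last 3 first.
  - by measurability.
  - by move=> t _; rewrite lee_fin.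
  - exact: laplace_ge0.
  apply: eq_integral => u _.
  rewrite -(@lebesgue_integralZl R _ (fun t => l t * expR (- (x * t))))//.
  have [u0|u0] := leP u 0.
    transitivity (0%E : \bar R); last apply: esym; apply: integral0_eq => r _.
      by rewrite ks// !mul0r.
    by rewrite /A ks// !(mul0r, mulr0) if_same.
  apply: (etrans (@ge0_integral_scale R u
    (fun t => (k u * expR (- (x * u)) * (l t * expR (- (x * t))))%:E) u0 _ _)).
  - by measurability.
  - by move=> t; rewrite lee_fin mulr_ge0.
  apply: (etrans (esym (@lebesgue_integralZl R u
    (fun t => k u * expR (- (x * u)) * (l (u * t) * expR (- (x * (u * t))))) _ _ _))).
  - exact: ltW.
  - by measurability.
  - by move=> t; rewrite mulr_ge0.
  apply: eq_integral => r _; congr (_%:E); rewrite /A.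
  case: ltP => r0; last by rewrite ls ?mul0r ?mulr0// pmulr_rle0.
  rewrite max_l ?(ltW u0)//.
  have -> : - (x * (u * (1 + r))) = - (x * u) - (x * (u * r)) by ring.
  by rewrite expRD; ring.
transitivity (\int[mu]_r \int[mu]_u (A u r)%:E)%E; first exact: lebesgue_tonelli.
transitivity (\int[mu]_r \int[mu]_t (B t r)%:E)%E.
  apply: eq_integral => r _.
  have [r0|r0] := leP r 0.
    transitivity (0%E : \bar R); last apply: esym; apply: integral0_eq => t _.
      by rewrite /A ltNge r0.
    by rewrite /B /mult_conv_kernel [0 < r]ltNge r0 andbF mul0r.
  have r1 : 0 < (1 + r)^-1 by rewrite invr_gt0 ltr_wpDl.
  apply: (etrans (@ge0_integral_scale R (1 + r)^-1 (fun u => (A u r)%:E) r1 _ _)).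
  - by rewrite /A; measurability.
  - by move=> t; rewrite lee_fin.
  apply: (etrans (esym (@lebesgue_integralZl R (1 + r)^-1
    (fun t => A ((1 + r)^-1 * t) r) _ _ _))).
  - exact: ltW.
  - by rewrite /A; measurability.
  - by move=> t.
  apply: eq_integral => t _; congr (_%:E); rewrite /A /B /mult_conv_kernel r0 andbT.
  have -> : (1 + r)^-1 * t * (1 + r) = t.
    by rewrite mulrAC mulVf ?mul1r// -invr_eq0 gt_eqF.
  case: ltP => t0.
    rewrite max_l ?mulr_ge0 ?(ltW r1) ?(ltW t0)// [(1 + r)^-1 * t]mulrC.
    by ring.
  by rewrite (ks ((1 + r)^-1 * t)) ?pmulr_rle0// !(mul0r, mulr0).
transitivity (\int[mu]_t \int[mu]_r (B t r)%:E)%E; first exact/esym/lebesgue_tonelli.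
apply: eq_integral => t _.
rewrite -(@ge0_integralZr _ _ R mu setT measurableT
    (fun r => (mult_conv_kernel k l t r)%:E)); last 3 first.
- by apply/measurable_EFinP; rewrite /mult_conv_kernel; measurability.
- by move=> r _; rewrite lee_fin mult_conv_kernel_ge0.
- by rewrite lee_fin expR_ge0.
by apply: eq_integral => r _; rewrite -EFinM.
Qed.

Lemma measurable_mult_conv (R : realType) (k l : R -> R) :
  measurable_fun setT k -> measurable_fun setT l ->
  (forall t, 0 <= k t) -> (forall t, 0 <= l t) ->
  measurable_fun setT
    (fun t : R => \int[lebesgue_measure]_r (mult_conv_kernel k l t r)%:E)%E.
Proof.
move=> mk ml k0 l0.
apply: (measurable_fun_fubini_tonelli_F (m2 := lebesgue_measure)
  (fun z : R * R => (mult_conv_kernel k l z.1 z.2)%:E)).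
  by apply/measurable_EFinP; exact: measurable_mult_conv_kernel.
by move=> z; rewrite lee_fin mult_conv_kernel_ge0.
Qed.

Lemma laplace_representableM (R : realType) (f g : R -> R) :
  laplace_representable f -> laplace_representable g ->
  laplace_representable (fun x => f x * g x).
Proof.
move=> [k [mk k0 ks kf]] [l [ml l0 ls lg]].
apply: (@laplace_representable_ext _ (fun x => f x * g x - 0)).
  by move=> x _; rewrite subr0.
pose K (t : R) := (\int[lebesgue_measure]_r (mult_conv_kernel k l t r)%:E)%E.
apply: (@laplace_representableB _ _ _ K (cst 0%E)) => //.
- exact: measurable_mult_conv.
- move=> t; rewrite lexx; apply: integral_ge0 => r _.
  by rewrite lee_fin mult_conv_kernel_ge0.
- move=> t t0; apply: integral0_eq => r _.
  by rewrite /mult_conv_kernel ltNge t0.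
- by move=> x x0; rewrite -laplaceM// kf// lg// EFinM.
- by move=> x _; apply: integral0_eq => t _; rewrite mul0e.
Qed.

(** * Integrals of densities that cross once *)

(** With c the supremum of M on the set where h1 < h2, the function
    (M - c)(h1 - h2) is nonnegative, and the constant c drops out because h1 and h2
    have the same integral.  If h2 is nowhere smaller than h1, no such c need exist,
    but then h1 and h2 agree almost everywhere. *)
Lemma single_crossing_integral_le (R : realType) (h1 h2 M : R -> R) (J : R) :
  measurable_fun setT h1 -> measurable_fun setT h2 -> measurable_fun setT M ->
  (forall r, 0 <= h1 r) -> (forall r, 0 <= h2 r) -> (forall r, 0 <= M r) ->
  (\int[lebesgue_measure]_r (h1 r)%:E = J%:E)%E ->
  (\int[lebesgue_measure]_r (h2 r)%:E = J%:E)%E ->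
  (forall r r', h1 r < h2 r -> h2 r' < h1 r' -> M r <= M r') ->
  (\int[lebesgue_measure]_r (M r * h2 r)%:E <=
   \int[lebesgue_measure]_r (M r * h1 r)%:E)%E.
Proof.
move=> mh1 mh2 mM h10 h20 M0 J1 J2 cross.
have mMh1 : measurable_fun setT (fun r => (M r * h1 r)%:E) by measurability.
have mMh2 : measurable_fun setT (fun r => (M r * h2 r)%:E) by measurability.
have [[r1 hr1]|no1] := pselect (exists r, h2 r < h1 r); last first.
  have h12 r : h1 r <= h2 r by rewrite leNgt; apply/negP => ?; apply: no1; exists r.
  have dh0 r : 0 <= h2 r - h1 r by rewrite subr_ge0.
  have d0 : (\int[lebesgue_measure]_r `|(h2 r - h1 r)%:E| = 0)%E.
    have : (\int[lebesgue_measure]_r (h1 r)%:E +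
        \int[lebesgue_measure]_r (h2 r - h1 r)%:E =
        \int[lebesgue_measure]_r (h2 r)%:E)%E.
      rewrite -ge0_integralD//.
      - by apply: eq_integral => r _; rewrite -EFinD addrC subrK.
      - by move=> r _; rewrite lee_fin.
      - by measurability.
      - by move=> r _; rewrite lee_fin.
      - by measurability.
    rewrite J1 J2 => JI.
    transitivity (\int[lebesgue_measure]_r (h2 r - h1 r)%:E)%E.
      by apply: eq_integral => r _; rewrite gee0_abs ?lee_fin.
    case: (\int[lebesgue_measure]_r (h2 r - h1 r)%:E)%E JI => //= i.
    by rewrite -EFinD => -[/eqP]; rewrite -subr_eq0 addrAC subrr add0r => /eqP ->.
  have mdh : measurable_fun setT (fun r => (h2 r - h1 r)%:E) by measurability.
  have [ae0 _] := @ae_eq_integral_abs _ _ R lebesgue_measure setT measurableT _ mdh.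
  rewrite le_eqVlt; apply/orP; left; apply/eqP.
  apply: ge0_ae_eq_integral => //.
  - by move=> r _; rewrite lee_fin mulr_ge0.
  - by move=> r _; rewrite lee_fin mulr_ge0.
  move: (ae0 d0); apply: filterS => r /= /(_ I)[/eqP].
  by rewrite subr_eq0 => /eqP ->.
pose S := [set M r | r in [set r | h1 r < h2 r]].
have [S0|/set0P[_ [r2 /= hr2 _]]] := eqVneq S set0.
  apply: ge0_le_integral => //.
  - by move=> r _; rewrite lee_fin mulr_ge0.
  - move=> r _; rewrite lee_fin ler_wpM2l// leNgt; apply/negP => hr.
    have : S (M r) by exists r.
    by rewrite S0.
have ubS : ubound S (M r1) by move=> _ [r hr <-]; exact: cross.
have hS : has_sup S by split; [exists (M r2), r2 | exists (M r1)].
pose c := sup S.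
have cS r : h1 r < h2 r -> M r <= c by move=> hr; apply: sup_upper_bound => //; exists r.
have Sc r : h2 r < h1 r -> c <= M r.
  by move=> hr; apply: ge_sup; [case: hS|move=> _ [r' hr' <-]; exact: cross].
have c0 : 0 <= c by rewrite (le_trans (M0 r2))// cS.
have : (\int[lebesgue_measure]_r (M r * h2 r + c * h1 r)%:E <=
        \int[lebesgue_measure]_r (M r * h1 r + c * h2 r)%:E)%E.
  apply: ge0_le_integral => //.
  - by move=> r _; rewrite lee_fin addr_ge0 ?mulr_ge0.
  - by measurability.
  - by measurability.
  move=> r _; rewrite lee_fin -subr_ge0.
  have -> : M r * h1 r + c * h2 r - (M r * h2 r + c * h1 r) =
    (M r - c) * (h1 r - h2 r) by ring.
  have [hr|hr|->] := ltgtP (h1 r) (h2 r); last by rewrite subrr mulr0.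
  - by rewrite mulr_le0// subr_le0 ?cS// ltW.
  - by rewrite mulr_ge0// subr_ge0 ?Sc// ltW.
have split_int (f g : R -> R) : measurable_fun setT f -> measurable_fun setT g ->
    (forall r, 0 <= f r) -> (forall r, 0 <= g r) ->
    (\int[lebesgue_measure]_r (f r + c * g r)%:E =
     \int[lebesgue_measure]_r (f r)%:E + c%:E * \int[lebesgue_measure]_r (g r)%:E)%E.
  move=> mf mg f0 g0; rewrite -(@lebesgue_integralZl R c g)//.
  rewrite -ge0_integralD//.
  - by move=> r _; rewrite lee_fin.
  - by measurability.
  - by move=> r _; rewrite lee_fin mulr_ge0.
  - by measurability.
rewrite (split_int (fun r => M r * h2 r) h1)//; last 2 first.
- by measurability.
- by move=> r; rewrite mulr_ge0.
rewrite (split_int (fun r => M r * h1 r) h2)//; last 2 first.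
- by measurability.
- by move=> r; rewrite mulr_ge0.
by rewrite J1 J2 -EFinM leeD2rE.
Qed.

(** (1 + xy)/(x + y) is nondecreasing in each variable as long as the other one is
    at least 1. *)
Lemma crossing_ratio (R : realFieldType) (x y x' y' : R) :
  1 <= x -> 1 <= y -> x <= x' -> y <= y' ->
  (1 + x * y) * (x' + y') <= (1 + x' * y') * (x + y).
Proof.
move=> x1 y1 xx' yy'.
have step (u u' v : R) : 1 <= u -> u <= u' -> 1 <= v ->
    (1 + u * v) * (u' + v) <= (1 + u' * v) * (u + v).
  move=> u1 uu' v1; rewrite -subr_ge0.
  have -> : (1 + u' * v) * (u + v) - (1 + u * v) * (u' + v) =
    (u' - u) * ((v - 1) * (v + 1)) by ring.
  by rewrite !mulr_ge0// ?subr_ge0// addr_ge0 ?(le_trans ler01).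
have s1 := step x x' y x1 xx' y1.
have := step y y' x' y1 yy' (le_trans x1 xx').
rewrite [y * x']mulrC [y' * x']mulrC [y' + x']addrC [y + x']addrC => s2.
have p : 0 < x' + y by lra.
rewrite -(ler_pM2r p).
have f0 : 0 <= x' + y' by lra.
have b0 : 0 <= x + y by lra.
have := ler_wpM2l f0 s1; have := ler_wpM2l b0 s2; lra.
Qed.

(** * Symmetrized beta densities *)

(** The exponential of |log r|: it measures the distance of the pair (u, w), with
    w = ur, from the diagonal. *)
Definition fold_ratio (R : realType) (r : R) : R := if 1 <= r then r else r^-1.

Lemma fold_ratio_ge1 (R : realType) (r : R) : 0 < r -> 1 <= fold_ratio r.
Proof.
move=> r0; rewrite /fold_ratio; have [//|/ltW r1] := leP 1 r.
by rewrite invf_ge1.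
Qed.

(** Up to a constant, the quotient of two symmetrized beta densities with parameters
    (b'+B+C, b') and (b'+B, b'+C). *)
Definition crossing_quotient (R : realType) (B C r : R) : R :=
  (1 + r `^ B * r `^ C) / (r `^ B + r `^ C).

(** Exchanging r and 1/r multiplies numerator and denominator by the same power. *)
Lemma crossing_quotient_fold (R : realType) (B C r : R) : 0 < r ->
  crossing_quotient B C (fold_ratio r) = crossing_quotient B C r.
Proof.
move=> r0; rewrite /fold_ratio; case: ifP => // _.
rewrite /crossing_quotient -powR_inv1 ?(ltW r0)// -!powRrM !mulN1r !powRN.
have := powR_gt0 B r0; have := powR_gt0 C r0.
move: (r `^ B) (r `^ C) => X Y Y0 X0.
by field; rewrite !gt_eqF ?addr_gt0.
Qed.

Lemma crossing_quotient_le (R : realType) (B C r r' : R) : 0 <= B -> 0 <= C ->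
  0 < r -> 0 < r' -> fold_ratio r <= fold_ratio r' ->
  crossing_quotient B C r <= crossing_quotient B C r'.
Proof.
move=> B0 C0 r0 r'0; rewrite -(crossing_quotient_fold B C r0).
rewrite -(crossing_quotient_fold B C r'0).
move: (fold_ratio_ge1 r0) (fold_ratio_ge1 r'0).
move: (fold_ratio r) (fold_ratio r') => s s' s1 s'1 ss'.
have s0 : 0 < s by rewrite (lt_le_trans _ s1).
have s'0 : 0 < s' by rewrite (lt_le_trans _ s'1).
rewrite /crossing_quotient ler_pdivrMr ?addr_gt0 ?powR_gt0//.
rewrite mulrAC ler_pdivlMr ?addr_gt0 ?powR_gt0//.
apply: crossing_ratio.
- by rewrite -(powRr0 s) ler_powR.
- by rewrite -(powRr0 s) ler_powR.
- by rewrite ge0_ler_powR// nnegrE ltW.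
- by rewrite ge0_ler_powR// nnegrE ltW.
Qed.

(** The two strict inequalities bound the quotients v/u and v'/u' by c'/c from opposite
    sides. *)
Lemma scaled_crossing (R : realFieldType) (c c' d d' e e' u u' v v' : R) :
  0 < c -> 0 < c' -> 0 < d -> 0 < d' -> 0 < e -> 0 < e' -> 0 < u -> 0 < u' ->
  d * u * e / c < d * v * e / c' -> d' * v' * e' / c' < d' * u' * e' / c ->
  v' / u' < v / u.
Proof.
move=> c0 c'0 d0 d'0 e0 e'0 u0 u'0.
rewrite ![d * _ * e]mulrAC ![d' * _ * e']mulrAC -!(mulrA (_ * _)).
rewrite !ltr_pM2l ?mulr_gt0// => h1 h2.
rewrite ltr_pdivrMr// mulrAC ltr_pdivlMr//.
move: h1 h2; rewrite !ltr_pdivrMr// ![_ / _ * _]mulrAC !ltr_pdivlMr// => h1 h2.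
have k1 : u * c' * u' < v * c * u' by rewrite ltr_pM2r.
have k2 : v' * c * u < u' * c' * u by rewrite ltr_pM2r.
rewrite -(ltr_pM2r c0); lra.
Qed.

(** The beta prime density with parameters a and b, symmetrized under exchange of a
    and b.  It is normalized to mass 2/Gamma(a+b), which depends on a + b only. *)
Definition beta_density (R : realType) (a b r : R) : R :=
  if 0 < r then (r `^ (a - 1) + r `^ (b - 1)) * (1 + r) `^ (- (a + b))
    / (euler_gamma a * euler_gamma b) else 0.

Lemma measurable_beta_density (R : realType) (a b : R) :
  measurable_fun setT (beta_density a b).
Proof. by rewrite /beta_density; measurability. Qed.

Lemma beta_density_ge0 (R : realType) (a b r : R) : 0 < a -> 0 < b ->
  0 <= beta_density a b r.
Proof.
move=> a0 b0; rewrite /beta_density; case: ifP => // r0.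
by rewrite divr_ge0 ?mulr_ge0 ?addr_ge0 ?powR_ge0 ?ltW ?euler_gamma_gt0.
Qed.

(** The quotient of the two densities is monotone in the distance from the diagonal,
    so points where it lies on either side of 1 are ordered by that distance. *)
Lemma beta_density_crossing (R : realType) (a b a' b' r r' : R) :
  0 < b' -> b' <= b -> b' <= a -> a + b = a' + b' ->
  beta_density a b r < beta_density a' b' r ->
  beta_density a' b' r' < beta_density a b r' ->
  [/\ 0 < r, 0 < r' & fold_ratio r' <= fold_ratio r].
Proof.
move=> b'0 b'b b'a sE.
have b0 : 0 < b by lra. have a0 : 0 < a by lra. have a'0 : 0 < a' by lra.
rewrite /beta_density; have [r0|_] := ltP 0 r; last by rewrite ltxx.
have [r'0|_] := ltP 0 r'; last by rewrite ltxx.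
pose B := a - b'; pose C := b - b'.
have B0 : 0 <= B by rewrite subr_ge0.
have C0 : 0 <= C by rewrite subr_ge0.
have fac s : 0 < s -> s `^ (a - 1) + s `^ (b - 1) = s `^ (b' - 1) * (s `^ B + s `^ C).
  move=> s0; rewrite mulrDr -!powRD ?(gt_eqF s0) ?implybT//.
  by congr (_ `^ _ + _ `^ _); rewrite /B /C; ring.
have fac' s : 0 < s -> s `^ (a' - 1) + s `^ (b' - 1) = s `^ (b' - 1) * (1 + s `^ B * s `^ C).
  move=> s0; rewrite mulrDr mulr1 addrC -!powRD ?(gt_eqF s0) ?implybT//.
  by congr (_ + _ `^ _); rewrite /B /C; lra.
have cpos : 0 < euler_gamma a * euler_gamma b by rewrite mulr_gt0 ?euler_gamma_gt0.
have c'pos : 0 < euler_gamma a' * euler_gamma b' by rewrite mulr_gt0 ?euler_gamma_gt0.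
move=> h h'; split => //; rewrite leNgt; apply/negP => /ltW rr'.
have := crossing_quotient_le B0 C0 r0 r'0 rr'.
apply/negP; rewrite -ltNge /crossing_quotient.
move: h h'; rewrite -sE (fac _ r0) (fac' _ r0) (fac _ r'0) (fac' _ r'0).
have xy s : 0 < s -> 0 < s `^ B + s `^ C by move=> s0; rewrite addr_gt0 ?powR_gt0.
have z1 s : 0 < s -> 0 < (1 + s) `^ (- (a + b)) by move=> s0; rewrite powR_gt0 ?addr_gt0.
exact: (scaled_crossing cpos c'pos (powR_gt0 _ r0) (powR_gt0 _ r'0) (z1 r r0)
  (z1 r' r'0) (xy r r0) (xy r' r'0)).
Qed.

(** theta(u) theta(w) at the point u = t/(1+r), w = tr/(1+r) of the line u + w = t. *)
Definition pair_kernel (R : realType) (theta : R -> R) (t r : R) : R :=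
  theta (t * (1 + r)^-1) * theta (t * (1 + r)^-1 * r).

Lemma pair_kernel_fold (R : realType) (theta : R -> R) (t r : R) : 0 < r ->
  pair_kernel theta t (fold_ratio r) = pair_kernel theta t r.
Proof.
move=> r0; rewrite /fold_ratio; case: ifP => // _.
have r1 : 1 + r != 0 by rewrite gt_eqF ?addr_gt0.
have rn0 : r != 0 by rewrite gt_eqF.
have e : (1 + r^-1)^-1 = (1 + r)^-1 * r.
  have -> : 1 + r^-1 = (1 + r) / r by rewrite mulrDl mul1r divff// addrC.
  by rewrite invfM invrK.
by rewrite /pair_kernel e mulrA mulfK// mulrC.
Qed.

(** Moving r towards 1 moves the pair (u, w) towards the diagonal; the pairs are
    written with the smaller entry first. *)
Lemma pair_kernel_nested (R : realType) (theta : R -> R) (t r r' : R) :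
  0 < t -> 0 < r -> 0 < r' -> fold_ratio r' <= fold_ratio r ->
  exists u u' w' w : R,
    [/\ 0 < u, u <= u', u' <= w', w' <= w & u + w = u' + w'] /\
    pair_kernel theta t r = theta u * theta w /\
    pair_kernel theta t r' = theta u' * theta w'.
Proof.
move=> t0 r0 r'0; rewrite -(pair_kernel_fold _ _ r0) -(pair_kernel_fold _ _ r'0).
move: (fold_ratio_ge1 r0) (fold_ratio_ge1 r'0).
move: (fold_ratio r) (fold_ratio r') => s s' s1 s'1 ss'.
have s0 : 0 < 1 + s by lra.
have s'0 : 0 < 1 + s' by lra.
have sum x : 0 < 1 + x -> t * (1 + x)^-1 + t * (1 + x)^-1 * x = t.
  by move=> x0; rewrite -[X in X + _]mulr1 -mulrDr mulfVK// gt_eqF.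
have uu' : t * (1 + s)^-1 <= t * (1 + s')^-1.
  by rewrite ler_pM2l// lef_pV2 ?posrE// lerD2l.
exists (t * (1 + s)^-1), (t * (1 + s')^-1), (t * (1 + s')^-1 * s'), (t * (1 + s)^-1 * s).
split=> //; split.
- by rewrite divr_gt0.
- exact: uu'.
- by rewrite ler_peMr// ltW// divr_gt0.
- by have := sum s s0; have := sum s' s'0; lra.
- by rewrite !sum.
Qed.

(** * Two-factor products and their differences *)

(** The point of the coordinates (t, r): the powers contribute a factor depending on
    t alone and a beta density in r. *)
Lemma mult_conv_kernel_pow (R : realType) (theta : R -> R) (a b t r : R) :
  0 < a -> 0 < b ->
  mult_conv_kernel (fun s => pow_density a s * theta s)
    (fun s => pow_density b s * theta s) t r =
  if 0 < r then pow_density (a + b) t * pair_kernel theta t r *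
    (r `^ (b - 1) * (1 + r) `^ (- (a + b))) else 0.
Proof.
move=> a0 b0; rewrite /mult_conv_kernel /pow_density.
have [t0|t0] := ltP 0 t; last by rewrite !mul0r if_same.
have [r0|r0] := ltP 0 r; last by [].
have d0 : 0 < (1 + r)^-1 by rewrite invr_gt0 addr_gt0.
have td0 : 0 < t * (1 + r)^-1 by rewrite mulr_gt0.
have tdr0 : 0 < t * (1 + r)^-1 * r by rewrite mulr_gt0.
rewrite td0 tdr0 /pair_kernel.
set d := (1 + r)^-1 in d0 td0 tdr0 *; set th := theta _; set th' := theta _.
have -> : (1 + r) `^ (- (a + b)) = d `^ a * d `^ b.
  rewrite -powRD ?(gt_eqF d0) ?implybT// /d -powR_inv1 ?addr_ge0 ?(ltW r0)//.
  by rewrite -powRrM mulN1r.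
have -> : t `^ (a + b - 1) = t * t `^ (a - 1) * t `^ (b - 1).
  rewrite mulr_powRB1 ?(ltW t0)// -powRD ?(gt_eqF t0) ?implybT//.
  by rewrite addrA.
rewrite !powRM ?(ltW d0) ?(ltW r0) ?(ltW t0) ?(ltW td0)//.
rewrite -(mulr_powRB1 (ltW d0) a0) -(mulr_powRB1 (ltW d0) b0).
by ring.
Qed.

(** Adding the two orders of the factors makes the measure in r invariant under
    r |-> 1/r, as the comparison of beta densities requires, without a change of
    variables. *)
Lemma laplaceM_sym (R : realType) (k l : R -> R) (c x : R) : 0 <= c ->
  measurable_fun setT k -> measurable_fun setT l ->
  (forall t, 0 <= k t) -> (forall t, 0 <= l t) ->
  (forall t : R, t <= 0 -> k t = 0) -> (forall t : R, t <= 0 -> l t = 0) ->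
  (\int[lebesgue_measure]_t
    (\int[lebesgue_measure]_r
       (c * (mult_conv_kernel k l t r + mult_conv_kernel l k t r))%:E
      * (expR (- (x * t)))%:E) =
   c%:E * (laplace k x * laplace l x + laplace l x * laplace k x))%E.
Proof.
move=> c0 mk ml k0 l0 ks ls.
pose mu := @lebesgue_measure R.
pose P t := (\int[mu]_r (mult_conv_kernel k l t r)%:E)%E.
pose Q t := (\int[mu]_r (mult_conv_kernel l k t r)%:E)%E.
have P0 t : (0 <= P t)%E.
  by apply: integral_ge0 => r _; rewrite lee_fin mult_conv_kernel_ge0.
have Q0 t : (0 <= Q t)%E.
  by apply: integral_ge0 => r _; rewrite lee_fin mult_conv_kernel_ge0.
have me : measurable_fun setT (fun t : R => (expR (- (x * t)))%:E) by measurability.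
have mPe : measurable_fun setT (fun t : R => P t * (expR (- (x * t)))%:E)%E.
  by apply: emeasurable_funM => //; exact: measurable_mult_conv.
have mQe : measurable_fun setT (fun t : R => Q t * (expR (- (x * t)))%:E)%E.
  by apply: emeasurable_funM => //; exact: measurable_mult_conv.
have Pe0 t : (0 <= P t * (expR (- (x * t)))%:E)%E by rewrite mule_ge0// lee_fin expR_ge0.
have Qe0 t : (0 <= Q t * (expR (- (x * t)))%:E)%E by rewrite mule_ge0// lee_fin expR_ge0.
transitivity (\int[mu]_t (c%:E *
  (P t * (expR (- (x * t)))%:E + Q t * (expR (- (x * t)))%:E)))%E.
  apply: eq_integral => t _.
  have mkl : measurable_fun setT (mult_conv_kernel k l t).
    by rewrite /mult_conv_kernel; measurability.
  have mlk : measurable_fun setT (mult_conv_kernel l k t).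
    by rewrite /mult_conv_kernel; measurability.
  have kl0 r : 0 <= mult_conv_kernel k l t r by exact: mult_conv_kernel_ge0.
  have lk0 r : 0 <= mult_conv_kernel l k t r by exact: mult_conv_kernel_ge0.
  rewrite (@lebesgue_integralZl R c
    (fun r => mult_conv_kernel k l t r + mult_conv_kernel l k t r))//; last 2 first.
  - by measurability.
  - by move=> r; rewrite addr_ge0.
  rewrite -muleA -ge0_muleDl//; congr (_ * (_ * _))%E.
  rewrite -ge0_integralD//.
  - by move=> r _; rewrite lee_fin.
  - by measurability.
  - by move=> r _; rewrite lee_fin.
  - by measurability.
rewrite (@ge0_integralZl _ _ R mu setT measurableT
  (fun t => P t * (expR (- (x * t)))%:E + Q t * (expR (- (x * t)))%:E)%E)//; last 2 first.
- exact: emeasurable_funD.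
- by move=> t _; rewrite adde_ge0.
congr (_ * _)%E; rewrite (@ge0_integralD _ _ R mu)//.
by rewrite -laplaceM// -laplaceM.
Qed.

Lemma symmetrized_product (F : numFieldType) (g h x y : F) :
  g != 0 -> h != 0 ->
  (g * h)^-1 * (g * x * (h * y) + h * y * (g * x)) = 2 * (x * y).
Proof. by move=> g0 h0; field; rewrite g0 h0. Qed.

(** Division by Gamma(a) Gamma(b) turns the kernel into the symmetrized beta density;
    the factor 2 comes from the two orders of the factors. *)
Lemma laplace_pair (R : realType) (theta : R -> R) (a b x Fa Fb : R) :
  0 < a -> 0 < b -> measurable_fun setT theta -> (forall t, 0 <= theta t) ->
  laplace (fun t => pow_density a t * theta t) x = (euler_gamma a * Fa)%:E ->
  laplace (fun t => pow_density b t * theta t) x = (euler_gamma b * Fb)%:E ->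
  (\int[lebesgue_measure]_t
    (\int[lebesgue_measure]_r
       (pow_density (a + b) t * pair_kernel theta t r * beta_density a b r)%:E
      * (expR (- (x * t)))%:E) = (2 * (Fa * Fb))%:E)%E.
Proof.
move=> a0 b0 mth th0 HFa HFb.
have ga := euler_gamma_gt0 a0; have gb := euler_gamma_gt0 b0.
pose c := (euler_gamma a * euler_gamma b)^-1.
have c0 : 0 <= c by rewrite invr_ge0; apply/ltW/mulr_gt0.
have pma := measurable_pow_density a; have pmb := measurable_pow_density b.
have := @laplaceM_sym R (fun t => pow_density a t * theta t)
    (fun t => pow_density b t * theta t) c x c0.
rewrite HFa HFb => H.
apply: (etrans (etrans _ (H _ _ _ _ _ _))).
- apply: eq_integral => t _; congr (_ * _)%E; apply: eq_integral => r _.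
  congr (_%:E); rewrite !mult_conv_kernel_pow// /beta_density [b + a]addrC.
  by case: ifP => _; rewrite ?addr0 ?mulr0// -/c; ring.
- by measurability.
- by measurability.
- by move=> t; rewrite mulr_ge0 ?pow_density_ge0.
- by move=> t; rewrite mulr_ge0 ?pow_density_ge0.
- by move=> t t0; rewrite /pow_density ltNge t0 mul0r.
- by move=> t t0; rewrite /pow_density ltNge t0 mul0r.
- transitivity ((c * (euler_gamma a * Fa * (euler_gamma b * Fb) +
    euler_gamma b * Fb * (euler_gamma a * Fa)))%:E); first by [].
  by congr (_%:E); apply: symmetrized_product; rewrite gt_eqF.
Qed.

(** The case theta = 1 of the product formula: x^{-a} x^{-b} = x^{-(a+b)} at x = 1. *)
Lemma integral_beta_density (R : realType) (a b : R) : 0 < a -> 0 < b ->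
  (\int[lebesgue_measure]_r (beta_density a b r)%:E =
   (2 / euler_gamma (a + b))%:E)%E.
Proof.
move=> a0 b0; have ab0 : 0 < a + b by rewrite addr_gt0.
have pab := measurable_pow_density (a + b).
have mbd := measurable_beta_density a b.
have bd0 r : 0 <= beta_density a b r by exact: beta_density_ge0.
have one u : 0 < u ->
    laplace (fun t => pow_density u t * 1) 1 = (euler_gamma u * 1)%:E :> \bar R.
  move=> u0; rewrite mulr1 -euler_gammaE//; congr laplace.
  by apply/funext => t; rewrite mulr1.
have := laplace_pair a0 b0 (measurable_cst (1 : R)) (fun=> ler01) (one a a0) (one b b0).
pose J := (\int[lebesgue_measure]_r (beta_density a b r)%:E)%E; rewrite -/J.
have -> : (\int[lebesgue_measure]_t
    (\int[lebesgue_measure]_r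
       (pow_density (a + b) t * pair_kernel (fun=> 1) t r * beta_density a b r)%:E
      * (expR (- (1 * t)))%:E) = J * laplace (pow_density (a + b)) 1)%E.
  rewrite -ge0_integralZl//; last 3 first.
  - by measurability.
  - by move=> t _; rewrite lee_fin mulr_ge0 ?expR_ge0 ?pow_density_ge0.
  - by apply: integral_ge0 => r _; rewrite lee_fin.
  apply: eq_integral => t _; rewrite EFinM muleA; congr (_ * _)%E.
  rewrite muleC -(@lebesgue_integralZl R _ (beta_density a b)) ?pow_density_ge0//.
  by apply: eq_integral => r _; rewrite /pair_kernel !mulr1.
have g0 := euler_gamma_gt0 ab0.
rewrite euler_gammaE// !mulr1; case: J => [j| |].
- by rewrite -EFinM => -[<-]; rewrite mulfK// gt_eqF.
- by rewrite gt0_mulye ?lte_fin.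
- by rewrite gt0_mulNye ?lte_fin.
Qed.

Lemma measurable_pair_kernel (R : realType) (theta : R -> R) :
  measurable_fun setT theta ->
  measurable_fun setT (fun z : R * R => pair_kernel theta z.1 z.2).
Proof. by move=> mth; rewrite /pair_kernel; measurability. Qed.

(** For each t the density of the first product dominates that of the second, by the
    crossing hypothesis. *)
Lemma pair_difference_representable (R : realType) (theta : R -> R)
    (a b a' b' : R) (Fa Fb Fa' Fb' : R -> R) :
  0 < a -> 0 < b -> 0 < a' -> 0 < b' -> a + b = a' + b' ->
  measurable_fun setT theta -> (forall t, 0 <= theta t) ->
  (forall x : R, 0 < x ->
     laplace (fun t => pow_density a t * theta t) x = (euler_gamma a * Fa x)%:E) ->
  (forall x : R, 0 < x ->
     laplace (fun t => pow_density b t * theta t) x = (euler_gamma b * Fb x)%:E) ->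
  (forall x : R, 0 < x ->
     laplace (fun t => pow_density a' t * theta t) x = (euler_gamma a' * Fa' x)%:E) ->
  (forall x : R, 0 < x ->
     laplace (fun t => pow_density b' t * theta t) x = (euler_gamma b' * Fb' x)%:E) ->
  (forall t r r' : R, 0 < t -> beta_density a b r < beta_density a' b' r ->
     beta_density a' b' r' < beta_density a b r' ->
     pair_kernel theta t r <= pair_kernel theta t r') ->
  laplace_representable (fun x => Fa x * Fb x - Fa' x * Fb' x).
Proof.
move=> a0 b0 a'0 b'0 sE mth th0 HFa HFb HFa' HFb' cross.
apply: (@laplace_representable_ext _
  (fun x => 2^-1 * (2 * (Fa x * Fb x) - 2 * (Fa' x * Fb' x)))).
  by move=> x _; rewrite -mulrBr mulKf.
apply: laplace_representableZ => //.
have mpk := measurable_pair_kernel mth.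
have mp := measurable_pow_density (a + b).
have pk0 t r : 0 <= pair_kernel theta t r by rewrite mulr_ge0.
pose D c d t := (\int[lebesgue_measure]_r
  (pow_density (a + b) t * pair_kernel theta t r * beta_density c d r)%:E)%E.
have mD c d : 0 < c -> 0 < d -> measurable_fun setT (D c d).
  move=> c0 d0; have mb := measurable_beta_density c d.
  apply: (measurable_fun_fubini_tonelli_F (m2 := lebesgue_measure)
    (fun z : R * R => (pow_density (a + b) z.1 * pair_kernel theta z.1 z.2 *
       beta_density c d z.2)%:E)).
    apply/measurable_EFinP; apply: measurable_funM; last by measurability.
    by apply: measurable_funM => //; measurability.
  by move=> z; rewrite lee_fin !mulr_ge0 ?pow_density_ge0 ?beta_density_ge0.
apply: (@laplace_representableB _ _ _ (D a b) (D a' b')).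
- exact: mD.
- exact: mD.
- move=> t; apply/andP; split.
    apply: integral_ge0 => r _.
    by rewrite lee_fin !mulr_ge0 ?pow_density_ge0 ?beta_density_ge0.
  apply: (@single_crossing_integral_le R (beta_density a b) (beta_density a' b')
    (fun r => pow_density (a + b) t * pair_kernel theta t r) (2 / euler_gamma (a + b))).
  - exact: measurable_beta_density.
  - exact: measurable_beta_density.
  - by rewrite /pair_kernel; measurability.
  - by move=> r; exact: beta_density_ge0.
  - by move=> r; exact: beta_density_ge0.
  - by move=> r; rewrite mulr_ge0 ?pow_density_ge0.
  - exact: integral_beta_density.
  - by rewrite sE; exact: integral_beta_density.
  - move=> r r' h h'; have [t0|t0] := ltP 0 t; last first.
      by rewrite /pow_density ltNge t0 !mul0r.
    by rewrite ler_wpM2l ?pow_density_ge0//; exact: (cross t r r').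
- move=> t t0; apply: integral0_eq => r _.
  by rewrite /pow_density ltNge t0 !mul0r.
- by move=> x x0; exact: (laplace_pair a0 b0 mth th0 (HFa x x0) (HFb x x0)).
- move=> x x0; rewrite /D sE.
  exact: (laplace_pair a'0 b'0 mth th0 (HFa' x x0) (HFb' x x0)).
Qed.

(** * The weight 1/(1 - exp(-t)) *)

Lemma derivative_ge0_le (R : realType) (f f' : R -> R) (a b : R) : a <= b ->
  (forall x, a <= x <= b -> is_derive x 1 f (f' x)) ->
  (forall x, a <= x <= b -> 0 <= f' x) -> f a <= f b.
Proof.
move=> ab df f'0.
have [||c] := @MVT_segment R f f' a b ab _ _.
- by move=> x; rewrite in_itv/= => /andP[ax xb]; apply: df; rewrite !ltW.
- apply: derivable_within_continuous => x; rewrite in_itv/= => axb.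
  by have [] := df x axb.
- rewrite in_itv/= => cab E; rewrite -subr_ge0 E mulr_ge0 ?subr_ge0//.
  exact: f'0.
Qed.

(** Concavity in the form used for log theta: by the mean value theorem the two
    increments are f' at ordered points times the same length. *)
Lemma decreasing_derivative_four_points (R : realType) (f f' : R -> R)
    (u u' w' w : R) :
  (forall x : R, 0 < x -> is_derive x 1 f (f' x)) ->
  (forall x y : R, 0 < x -> x <= y -> f' y <= f' x) ->
  0 < u -> u <= u' -> u' <= w' -> w' <= w -> u + w = u' + w' ->
  f u + f w <= f u' + f w'.
Proof.
move=> df f'd u0 uu' u'w' w'w sE.
have mvt a b : 0 < a -> a <= b ->
    exists2 c, a <= c <= b & f b - f a = f' c * (b - a).
  move=> a0 ab; have [||c] := @MVT_segment R f f' a b ab _ _.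
  - by move=> x; rewrite in_itv/= => /andP[ax xb]; apply: df; rewrite (lt_trans a0).
  - apply: derivable_within_continuous => x; rewrite in_itv/= => /andP[ax _].
    by have [] := df x (lt_le_trans a0 ax).
  - by rewrite in_itv/= => cab E; exists c.
have [c /andP[uc cu'] E] := mvt _ _ u0 uu'.
have w'0 : 0 < w' by lra.
have [d /andP[w'd dw] E'] := mvt _ _ w'0 w'w.
have cd : f' d <= f' c by apply: f'd; lra.
have u'u : 0 <= u' - u by lra.
have := ler_wpM2r u'u cd.
have E2 : w - w' = u' - u by lra.
by rewrite -{1}E2 -E -E'; lra.
Qed.

(** The inequality y <= sinh y, from e^y >= 1 + y for both signs of y in the
    derivative. *)
Lemma double_le_expR_sub (R : realType) (y : R) : 0 <= y ->
  2 * y <= expR y - expR (- y).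
Proof.
move=> y0; rewrite -subr_ge0.
pose h (y : R) := expR y - expR (- y) - 2 * y.
have : h 0 <= h y.
  apply: (@derivative_ge0_le R h (fun y => expR y + expR (- y) - 2)) => // x _.
    by rewrite /h; apply: is_derive_eq; rewrite /GRing.scale/=; ring.
  by have := expR_ge1Dx x; have := expR_ge1Dx (- x); lra.
by rewrite /h oppr0 mulr0 !subr0 subrr.
Qed.

(** The function is the logarithmic derivative of t/(1 - e^{-t}); its derivative is
    nonpositive because z e^{z/2} <= e^z - 1. *)
Lemma inv_sub_inv_expm1_decr (R : realType) (x y : R) : 0 < x -> x <= y ->
  y^-1 - (expR y - 1)^-1 <= x^-1 - (expR x - 1)^-1.
Proof.
move=> x0 xy.
have e1 (z : R) : 0 < z -> 0 < expR z - 1 by move=> z0; rewrite subr_gt0 expR_gt1.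
pose g (z : R) := (expR z - 1)^-1 - z^-1.
suff : g x <= g y by rewrite /g; lra.
apply: (@derivative_ge0_le R g
  (fun z => - (expR z - 1) ^- 2 * expR z + z ^- 2)) => // z /andP[xz _];
  have z0 : 0 < z by exact: lt_le_trans xz.
- have n1 : expR z - 1 != 0 by rewrite gt_eqF ?e1.
  have n2 : z != 0 by rewrite gt_eqF.
  have d1 := @is_deriveV R (fun z => expR z - 1) z _ 1 n1 _.
  have d2 := @is_deriveV R id z _ 1 n2 _.
  rewrite /g; apply: is_derive_eq.
  by rewrite /GRing.scale/=; ring.
- rewrite addrC mulNr subr_ge0 mulrC.
  rewrite ler_pdivrMr ?exprn_gt0 ?e1// mulrC ler_pdivlMr ?exprn_gt0//.
  have z20 : 0 <= z / 2 by rewrite divr_ge0// ltW.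
  have := double_le_expR_sub z20; rewrite mulrC divfK//.
  have -> : expR z = expR (z / 2) ^+ 2 by rewrite expr2 -expRD; congr expR; field.
  have := expRN (z / 2); have := expR_gt0 (z / 2).
  move: (expR (z / 2)) (expR (- (z / 2))) => E E' E0 -> h.
  have k : z * E <= E ^+ 2 - 1.
    have := ler_wpM2r (ltW E0) h; rewrite mulrBl mulVf ?gt_eqF//.
  have zE : 0 <= z * E by apply: mulr_ge0; apply: ltW.
  have := ler_pM zE zE k k; rewrite -expr2 => k2.
  apply: le_trans (_ : (z * E) ^+ 2 <= _) => //; rewrite exprMn mulrC//.
Qed.

(** The density of zeta(p,x) relative to t^{p-1}/Gamma(p); it is the sum of the
    exponentials e^{-kt} over k >= 0. *)
Definition bose (R : realType) (t : R) : R :=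
  if 0 < t then (1 - expR (- t))^-1 else 0.

Lemma measurable_bose (R : realType) : measurable_fun setT (@bose R).
Proof. by rewrite /bose; measurability. Qed.

Lemma bose_denom_gt0 (R : realType) (t : R) : 0 < t -> 0 < 1 - expR (- t).
Proof. by move=> t0; rewrite subr_gt0 expR_lt1 oppr_lt0. Qed.

Lemma bose_ge0 (R : realType) (t : R) : 0 <= bose t.
Proof.
rewrite /bose; have [t0|//] := ltP 0 t.
by rewrite invr_ge0 ltW// bose_denom_gt0.
Qed.

(** The product of the denominators is 1 + e^{-(u+w)} - e^{-u} - e^{-w}, and
    e^{-u} + e^{-w} decreases when the pair moves inward, by convexity. *)
Lemma bose_outward (R : realType) (u u' w' w : R) :
  0 < u -> u <= u' -> u' <= w' -> w' <= w -> u + w = u' + w' ->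
  bose u' * bose w' <= bose u * bose w.
Proof.
move=> u0 uu' u'w' w'w sE.
have u'0 : 0 < u' by lra. have w'0 : 0 < w' by lra. have w0 : 0 < w by lra.
rewrite /bose u0 u'0 w'0 w0 -!invfM.
rewrite lef_pV2 ?posrE ?mulr_gt0 ?bose_denom_gt0//.
have -> : expR (- u) = expR (- u') * expR (u' - u) by rewrite -expRD; congr expR; ring.
have -> : expR (- w') = expR (- w) * expR (u' - u) by rewrite -expRD; congr expR; lra.
have : expR (- w) <= expR (- u') by rewrite ler_expR; lra.
have : 1 <= expR (u' - u) by rewrite -expR0 ler_expR; lra.
move: (expR _) (expR (- w)) (expR (u' - u)) => a b e e1 ba.
have := mulr_ge0 (_ : 0 <= a - b) (_ : 0 <= e - 1).
rewrite !subr_ge0 => /(_ ba e1); lra.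
Qed.

(** t/(1 - e^{-t}) is log-concave. *)
Lemma mul_bose_inward (R : realType) (u u' w' w : R) :
  0 < u -> u <= u' -> u' <= w' -> w' <= w -> u + w = u' + w' ->
  u * bose u * (w * bose w) <= u' * bose u' * (w' * bose w').
Proof.
move=> u0 uu' u'w' w'w sE.
have u'0 : 0 < u' by lra. have w'0 : 0 < w' by lra. have w0 : 0 < w by lra.
have pos (t : R) : 0 < t -> 0 < t * bose t.
  by move=> t0; rewrite /bose t0 divr_gt0// bose_denom_gt0.
rewrite -ler_ln; try by rewrite posrE mulr_gt0 ?pos.
have lnM2 (a b : R) : 0 < a -> 0 < b -> ln (a * b) = ln a + ln b.
  by move=> a0 b0; rewrite lnM ?posrE.
rewrite (lnM2 _ _ (pos u u0) (pos w w0)) (lnM2 _ _ (pos u' u'0) (pos w' w'0)).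
have E (t : R) : 0 < t -> ln (t * bose t) = ln t - ln (1 - expR (- t)).
  by move=> t0; rewrite /bose t0 ln_div ?posrE ?bose_denom_gt0.
rewrite !E//.
apply: (@decreasing_derivative_four_points R (fun t => ln t - ln (1 - expR (- t)))
  (fun t => t^-1 - (expR t - 1)^-1)) => //; last exact: inv_sub_inv_expm1_decr.
move=> x x0.
have d1 := is_derive1_ln x0.
have d2 := is_derive1_ln (bose_denom_gt0 x0).
apply: is_derive_eq.
rewrite /GRing.scale/= expRN.
have : 0 < expR x - 1 by rewrite subr_gt0 expR_gt1.
have := expR_gt0 x.
move: (expR x) => e e0 e1.
have n0 : e != 0 by rewrite gt_eqF.
have n1 : e - 1 != 0 by rewrite gt_eqF.
have n2 : x != 0 by rewrite gt_eqF.
by field; rewrite n0 n1 n2.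
Qed.

(** * The Hurwitz zeta function as a Laplace transform *)

Lemma nneseries_cvg (R : realType) (u : nat -> R) (s : R) :
  (forall k, 0 <= u k) ->
  (\sum_(k <oo) (u k)%:E)%E = s%:E -> series u @ \oo --> s.
Proof.
move=> u0 us.
have : cvgn (fun n => \sum_(0 <= k < n) (u k)%:E)%E.
  by apply: is_cvg_nneseries => k _ _; rewrite lee_fin.
rewrite /= us.
move=> /fine_cvg; apply: cvg_trans; apply: near_eq_cvg; near=> n.
by rewrite /= sumEFin.
Unshelve. all: by end_near. Qed.

Lemma cvg_nneseries (R : realType) (u : nat -> R) (s : R) :
  series u @ \oo --> s -> (\sum_(k <oo) (u k)%:E)%E = s%:E.
Proof.
move=> us; apply/cvg_lim => //.
have -> : (fun n => \sum_(0 <= k < n) (u k)%:E)%E = EFin \o series u.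
  by apply/funext => n; rewrite /= sumEFin.
by apply: cvg_comp us _; exact: cvg_refl.
Qed.

Lemma bose_geometric (R : realType) (t : R) : 0 < t ->
  (\sum_(k <oo) (expR (- (k%:R * t)))%:E)%E = (bose t)%:E.
Proof.
move=> t0; apply: cvg_nneseries.
have -> : (fun k => expR (- (k%:R * t))) = geometric 1 (expR (- t)).
  apply/funext => k; rewrite /= mul1r -expRM_natl -mulrN//.
rewrite /bose t0 -[X in _ --> X]mul1r; apply: cvg_geometric_series.
by rewrite ger0_norm ?expR_ge0// expR_lt1 oppr_lt0.
Qed.

Lemma bose_bounds (R : realType) (t : R) : 0 < t ->
  1 <= bose t /\ 1 <= t * bose t <= 1 + t.
Proof.
move=> t0; have d0 := bose_denom_gt0 t0; rewrite /bose t0.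
have e0 := expR_gt0 t; have e1 := expR_ge1Dx t; have e2 := expR_ge1Dx (- t).
split; first by rewrite invf_ge1// gerBl expR_ge0.
apply/andP; split; first by rewrite ler_pdivlMr// mul1r; lra.
rewrite ler_pdivrMr// mulrBr mulr1 expRN.
have : (1 + t) / expR t <= 1 by rewrite ler_pdivrMr// mul1r.
lra.
Qed.

(** From 1 <= chi(t) and 1 <= t chi(t) <= 1 + t.  Both the convergence of the zeta
    series and its asymptotics at 0 and infinity come from these bounds. *)
Lemma pow_bose_bounds (R : realType) (p t : R) :
  [/\ pow_density p t <= pow_density p t * bose t,
      pow_density (p - 1) t <= pow_density p t * bose t &
      pow_density p t * bose t <= pow_density (p - 1) t + pow_density p t].
Proof.
have E : pow_density p t = t * pow_density (p - 1) t.
  by rewrite mul_pow_density subrK.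
have p0 := pow_density_ge0 (p - 1) t.
have [t0|t0] := ltP 0 t; last first.
  by rewrite /pow_density ltNge t0/= !mul0r addr0 lexx.
have [b1 /andP[b2 b3]] := bose_bounds t0.
split.
- by rewrite ler_peMr// pow_density_ge0.
- by rewrite E mulrAC ler_peMl.
- rewrite E mulrAC.
  have -> : pow_density (p - 1) t + t * pow_density (p - 1) t =
    (1 + t) * pow_density (p - 1) t by ring.
  exact: ler_wpM2r.
Qed.

(** Integrates the geometric expansion of chi term by term; the sum is finite by the
    bound on chi, so that the real series converges as well. *)
Lemma hurwitz_laplace (R : realType) (p x : R) : 1 < p -> 0 < x ->
  laplace (fun t => pow_density p t * bose t) x =
  (euler_gamma p * hurwitz_zeta p x)%:E.
Proof.
move=> p1 x0; have p0 : 0 < p by lra.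
have p10 : 0 < p - 1 by rewrite subr_gt0.
have mp := measurable_pow_density p; have mp1 := measurable_pow_density (p - 1).
have mb := @measurable_bose R.
have g0 := euler_gamma_gt0 p0.
have fin : (laplace (fun t => pow_density p t * bose t)%R x < +oo)%E.
  apply: (@le_lt_trans _ _ (laplace (fun t => pow_density (p - 1) t + pow_density p t)%R x)).
    apply: laplace_le; [by measurability|by measurability|move=> t].
    rewrite mulr_ge0 ?pow_density_ge0 ?bose_ge0//=.
    by have [] := pow_bose_bounds p t.
  rewrite laplaceD//; try exact: pow_density_ge0.
  by rewrite !laplace_pow// -EFinD ltry.
have Lsum : laplace (fun t => pow_density p t * bose t) x =
    (\sum_(k <oo) (euler_gamma p * (k%:R + x) `^ (- p))%:E)%E.
  transitivity (\int[lebesgue_measure]_t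
      \sum_(k <oo) (pow_density p t * expR (- ((k%:R + x) * t)))%:E)%E.
    apply: eq_integral => t _.
    have [t0|t0] := ltP 0 t; last first.
      rewrite /pow_density ltNge t0/= !mul0r.
      by rewrite eseries0// => k _ _; rewrite mul0r.
    rewrite mulrAC EFinM -bose_geometric// -nneseriesZl//.
    apply: eq_eseriesr => k _; rewrite -EFinM -mulrA -expRD.
    by congr ((_ * expR _)%:E); ring.
  rewrite integral_nneseries//.
  - apply: eq_eseriesr => k _.
    rewrite -[LHS]/(laplace (pow_density p) (k%:R + x)) laplace_pow//.
    by rewrite ltr_wpDl.
  - by move=> k; measurability.
  - by move=> k t _; rewrite lee_fin mulr_ge0 ?pow_density_ge0 ?expR_ge0.
have L0 : (0 <= laplace (fun t => pow_density p t * bose t)%R x)%E.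
  by apply: laplace_ge0 => t; rewrite mulr_ge0 ?pow_density_ge0 ?bose_ge0.
have : exists s, laplace (fun t => pow_density p t * bose t) x = s%:E.
  exists (fine (laplace (fun t => pow_density p t * bose t) x)).
  by rewrite fineK// ge0_fin_numE.
move=> [s Ls]; rewrite Ls; congr (_%:E).
have cs : series (fun k => euler_gamma p * (k%:R + x) `^ (- p)) @ \oo --> s.
  apply: nneseries_cvg; last by rewrite -Lsum.
  by move=> k; rewrite mulr_ge0 ?powR_ge0 ?ltW.
rewrite /hurwitz_zeta.
have -> : series (fun k => 1 / (k%:R + x) `^ p) =
   (fun n => (euler_gamma p)^-1 * series (fun k => euler_gamma p * (k%:R + x) `^ (- p)) n).
  apply/funext => n; rewrite /series/= mulr_sumr; apply: eq_bigr => k _.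
  by rewrite mulKf ?gt_eqF// powRN div1r.
have -> : limn (fun n => (euler_gamma p)^-1 *
    series (fun k => euler_gamma p * (k%:R + x) `^ (- p)) n) = (euler_gamma p)^-1 * s.
  by apply/cvg_lim => //; apply: cvgM => //; exact: cvg_cst.
by rewrite mulVKf// gt_eqF.
Qed.

(** The bounds on the density, integrated; (p-1) Gamma(p-1) = Gamma(p) absorbs the
    factor p - 1. *)
Lemma hurwitz_bounds (R : realType) (p x : R) : 1 < p -> 0 < x ->
  [/\ x `^ (- p) <= hurwitz_zeta p x,
      x `^ (1 - p) <= (p - 1) * hurwitz_zeta p x &
      (p - 1) * hurwitz_zeta p x <= x `^ (1 - p) + (p - 1) * x `^ (- p)].
Proof.
move=> p1 x0; have p0 : 0 < p by lra.
have p10 : 0 < p - 1 by rewrite subr_gt0.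
have mp := measurable_pow_density p; have mp1 := measurable_pow_density (p - 1).
have mb := @measurable_bose R.
have g1 := euler_gamma_gt0 p10; have g0 := euler_gamma_gt0 p0.
have gS : euler_gamma p = (p - 1) * euler_gamma (p - 1).
  by have := euler_gammaS p10; rewrite subrK.
have w0 t : 0 <= pow_density p t * bose t by rewrite mulr_ge0 ?pow_density_ge0 ?bose_ge0.
have mw : measurable_fun setT (fun t => pow_density p t * bose t) by measurability.
have L := hurwitz_laplace p1 x0.
have Lp := laplace_pow p0 x0; have Lp1 := laplace_pow p10 x0.
rewrite opprB in Lp1.
have cancel a b : euler_gamma (p - 1) * a <= euler_gamma (p - 1) * b -> a <= b.
  by rewrite (ler_pM2l g1).
split.
- have := laplace_le x mp mw; rewrite Lp L lee_fin ler_pM2l//; apply=> t.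
  by have [? _ _] := pow_bose_bounds p t; rewrite pow_density_ge0.
- have := laplace_le x mp1 mw; rewrite Lp1 L lee_fin => H; apply: cancel.
  rewrite mulrCA mulrA -gS; apply: H => t.
  by have [_ ? _] := pow_bose_bounds p t; rewrite pow_density_ge0.
- have := @laplace_le R _ (fun t => pow_density (p - 1) t + pow_density p t) x mw.
  rewrite laplaceD//; try exact: pow_density_ge0.
  rewrite Lp1 Lp L -EFinD lee_fin => H; apply: cancel.
  rewrite mulrDr mulrCA mulrA -gS [X in _ <= _ + X]mulrCA [X in _ <= _ + X]mulrA -gS.
  apply: H => [|t]; first by measurability.
  by have [_ _ ?] := pow_bose_bounds p t; rewrite w0.
Qed.

Lemma hurwitz_gt0 (R : realType) (p x : R) : 1 < p -> 0 < x -> 0 < hurwitz_zeta p x.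
Proof.
by move=> p1 x0; have [h _ _] := hurwitz_bounds p1 x0; rewrite (lt_le_trans _ h)// powR_gt0.
Qed.

(** * Two-factor products of zeta functions *)

Lemma zeta_representable (R : realType) (p : R) : 1 < p ->
  laplace_representable (hurwitz_zeta p).
Proof.
move=> p1; have p0 : 0 < p by lra.
have g0 := euler_gamma_gt0 p0.
apply: (@laplace_representable_ext _
  (fun x => (euler_gamma p)^-1 * (euler_gamma p * hurwitz_zeta p x))).
  by move=> x _; rewrite mulKf// gt_eqF.
apply: laplace_representableZ; first by rewrite invr_ge0 ltW.
have mp := measurable_pow_density p; have mb := @measurable_bose R.
exists (fun t => pow_density p t * bose t); split.
- by measurability.
- by move=> t; rewrite mulr_ge0 ?pow_density_ge0 ?bose_ge0.
- by move=> t t0; rewrite /pow_density ltNge t0 mul0r.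
- by move=> x x0; exact: hurwitz_laplace.
Qed.

(** Here theta = chi, with exponents a, b; the product is larger away from the
    diagonal. *)
Lemma zeta_pair_representable (R : realType) (a b a' b' : R) :
  1 < b' -> b' <= b -> b' <= a -> a + b = a' + b' ->
  laplace_representable (fun x => hurwitz_zeta a' x * hurwitz_zeta b' x
    - hurwitz_zeta a x * hurwitz_zeta b x).
Proof.
move=> b'1 b'b b'a sE.
have a1 : 1 < a by lra. have b1 : 1 < b by lra. have a'1 : 1 < a' by lra.
have b'0 : 0 < b' by lra. have a'0 : 0 < a' by lra.
have a0 : 0 < a by lra. have b0 : 0 < b by lra.
apply: (@pair_difference_representable R (@bose R) a' b' a b) => //.
- exact: measurable_bose.
- exact: bose_ge0.
- by move=> x x0; exact: hurwitz_laplace.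
- by move=> x x0; exact: hurwitz_laplace.
- by move=> x x0; exact: hurwitz_laplace.
- by move=> x x0; exact: hurwitz_laplace.
- move=> t r r' t0 h h'.
  have [r'0 r0 rr'] := beta_density_crossing b'0 b'b b'a sE h' h.
  have [u [u' [w' [w [[u0 uu' u'w' w'w E] [-> ->]]]]]] :=
    pair_kernel_nested (@bose R) t0 r'0 r0 rr'.
  exact: bose_outward.
Qed.

(** Here theta = t chi(t), with exponents a - 1, b - 1; the product is larger near
    the diagonal. *)
Lemma weighted_zeta_pair_representable (R : realType) (a b a' b' : R) :
  1 < b' -> b' <= b -> b' <= a -> a + b = a' + b' ->
  laplace_representable (fun x =>
    (a - 1) * hurwitz_zeta a x * ((b - 1) * hurwitz_zeta b x)
    - (a' - 1) * hurwitz_zeta a' x * ((b' - 1) * hurwitz_zeta b' x)).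
Proof.
move=> b'1 b'b b'a sE.
have a1 : 1 < a by lra. have b1 : 1 < b by lra. have a'1 : 1 < a' by lra.
have b'0 : 0 < b' - 1 by lra. have a'0 : 0 < a' - 1 by lra.
have a0 : 0 < a - 1 by lra. have b0 : 0 < b - 1 by lra.
have b'b1 : b' - 1 <= b - 1 by lra. have b'a1 : b' - 1 <= a - 1 by lra.
have sE1 : a - 1 + (b - 1) = a' - 1 + (b' - 1) by lra.
have F p x : 1 < p -> 0 < x ->
    laplace (fun t => pow_density (p - 1) t * (t * bose t)) x =
    (euler_gamma (p - 1) * ((p - 1) * hurwitz_zeta p x))%:E.
  move=> p1 x0; have p10 : 0 < p - 1 by lra.
  have gS := euler_gammaS p10; rewrite subrK in gS.
  rewrite mulrCA mulrA -gS -hurwitz_laplace//; congr laplace.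
  by apply/funext => t; rewrite mulrCA mulrA mul_pow_density subrK.
have mb := @measurable_bose R.
apply: (@pair_difference_representable R (fun t => t * bose t)
  (a - 1) (b - 1) (a' - 1) (b' - 1)) => //.
- by measurability.
- move=> t; have [t0|t0] := ltP 0 t; last by rewrite /bose ltNge t0 mulr0.
  by rewrite mulr_ge0 ?bose_ge0 ?ltW.
- by move=> x x0; exact: F.
- by move=> x x0; exact: F.
- by move=> x x0; exact: F.
- by move=> x x0; exact: F.
- move=> t r r' t0 h h'.
  have [r0 r'0 rr'] := beta_density_crossing b'0 b'b1 b'a1 sE1 h h'.
  have [u [u' [w' [w [[u0 uu' u'w' w'w E] [-> ->]]]]]] :=
    pair_kernel_nested (fun t => t * bose t) t0 r0 r'0 rr'.
  exact: mul_bose_inward.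
Qed.

(** * Majorization as a chain of transfers *)

Definition transfer (R : realFieldType) (n : nat) (q : 'I_n -> R) (j k : 'I_n)
    (d : R) : 'I_n -> R :=
  fun i => q i - (i == j)%:R * d + (i == k)%:R * d.

Lemma sum_indicator (R : realFieldType) (n m : nat) (j : 'I_n) (d : R) :
  \sum_(i < n | (i < m)%N) ((i == j)%:R * d) = (j < m)%N%:R * d.
Proof.
rewrite big_mkcond (bigD1 j)//= eqxx big1 ?addr0.
  by case: ifP; rewrite ?mul1r ?mul0r.
by move=> i /negPf ->; rewrite mul0r if_same.
Qed.

Lemma sum_transfer (R : realFieldType) (n m : nat) (q : 'I_n -> R) (j k : 'I_n)
    (d : R) :
  \sum_(i < n | (i < m)%N) transfer q j k d i =
  \sum_(i < n | (i < m)%N) q i - (j < m)%N%:R * d + (k < m)%N%:R * d.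
Proof. by rewrite /transfer big_split sumrB/= !sum_indicator. Qed.

(** Let k be the first index with q_k < p_k, and j < k an index with p_j < q_j, which
    exists by the prefix inequality just after k.  Moving
    d = min(q_j - p_j, p_k - q_k) from q_j to q_k makes one more coordinate agree with p.  The prefix sums still
    dominate those of p, since before k every q_i is at least p_i.  The
    transfer moves the two entries closer without exchanging their order, as
    q_k + d <= p_k <= p_j <= q_j - d for the sorted vector p. *)
Lemma majorization_ind (R : realFieldType) (n : nat) (c : R)
    (Rel : ('I_n -> R) -> ('I_n -> R) -> Prop) (p : 'I_n -> R) :
  (forall f, Rel f f) ->
  (forall f g h, Rel f g -> Rel g h -> Rel f h) ->
  (forall (q : 'I_n -> R) (j k : 'I_n) (d : R), (forall i, c < q i) ->
     j != k -> 0 < d -> q k + d <= q j - d -> Rel (transfer q j k d) q) ->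
  (forall i, c < p i) ->
  (forall i j : 'I_n, (i <= j)%N -> p j <= p i) ->
  forall q : 'I_n -> R, (forall i, c < q i) ->
  (forall m : nat, \sum_(i < n | (i < m)%N) p i <= \sum_(i < n | (i < m)%N) q i) ->
  \sum_(i < n) q i = \sum_(i < n) p i ->
  Rel p q.
Proof.
move=> rel_refl rel_trans rel_step cp pmono q.
have [N] := ubnP #|[pred i | p i != q i]|.
elim: N q => // N IH q cardN cq prefix total.
have [/existsP[k0 qk0]|noless] := boolP [exists k, q k < p k]; last first.
  have qp i : p i <= q i.
    by rewrite leNgt; apply: contraNN noless => qi; apply/existsP; exists i.
  have -> : q = p; last exact: rel_refl.
  apply/funext => i; apply/eqP.
  have /psumr_eq0P E : \sum_(i < n) (q i - p i) = 0 by rewrite sumrB total subrr.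
  by rewrite -subr_eq0 E// => l _; rewrite subr_ge0.
have [k qk kmin] := @arg_minnP _ k0 (fun k => q k < p k) (@nat_of_ord n) qk0.
have below (i : 'I_n) : (i < k)%N -> p i <= q i.
  by move=> ik; rewrite leNgt; apply/negP => /kmin; rewrite leqNgt ik.
have [j jk qj] : exists2 j : 'I_n, (j < k)%N & p j < q j.
  apply: contrapT => nj; have := prefix k.+1; apply/negP; rewrite -ltNge.
  have eqbelow (i : 'I_n) : (i < k)%N -> q i = p i.
    move=> ik; apply/le_anti; rewrite below// andbT leNgt; apply/negP => pq.
    by apply: nj; exists i.
  rewrite (bigD1 k)//= [ltRHS](bigD1 k)//= ltr_leD//.
  apply: ler_sum => i /andP[]; rewrite ltnS leq_eqVlt => /orP[/eqP ik|ik _].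
    by have -> : i = k by [apply: val_inj]; rewrite eqxx.
  by rewrite eqbelow.
have jNk : j != k by apply: contraTneq jk => ->; rewrite ltnn.
(* The largest transfer that keeps q_j >= p_j and q_k <= p_k; it makes one of them
   an equality. *)
pose d := Num.min (q j - p j) (p k - q k).
have d0 : 0 < d by rewrite lt_min !subr_gt0 qj.
have dj : d <= q j - p j by rewrite ge_min lexx.
have dk : d <= p k - q k by rewrite ge_min lexx orbT.
have pjk : p k <= p j by rewrite pmono// ltnW.
have qjE : transfer q j k d j = q j - d.
  by rewrite /transfer eqxx (negPf jNk) mul1r mul0r addr0.
have qkE : transfer q j k d k = q k + d.
  by rewrite /transfer eqxx [k == j]eq_sym (negPf jNk) mul1r mul0r subr0.
have qiE i : i != j -> i != k -> transfer q j k d i = q i.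
  by move=> /negPf ij /negPf ik; rewrite /transfer ij ik !mul0r subr0 addr0.
apply: (rel_trans _ (transfer q j k d)); last first.
  by apply: rel_step => //; lra.
apply: IH.
- apply: (@leq_trans #|[pred i | p i != q i]|) => //.
  apply: proper_card; apply/properP; split.
    apply/fintype.subsetP => i; rewrite !inE.
    have [->|ij] := eqVneq i j; first by move=> _; rewrite lt_eqF.
    have [->|ik] := eqVneq i k; first by move=> _; rewrite gt_eqF.
    by rewrite qiE.
  have [djk|djk] := leP (q j - p j) (p k - q k).
    exists j; rewrite !inE; first by rewrite lt_eqF.
    rewrite negbK qjE /d (min_idPl djk).
    by apply/eqP; lra.
  exists k; rewrite !inE; first by rewrite gt_eqF.
  rewrite negbK qkE /d (min_idPr (ltW djk)).
  by apply/eqP; lra.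
- move=> i; have [->|ij] := eqVneq i j; first by rewrite qjE; have := cp j; lra.
  have [->|ik] := eqVneq i k; first by rewrite qkE; have := cq k; lra.
  by rewrite qiE.
- move=> m; rewrite sum_transfer.
  have [km|mk] := ltnP k m.
    by rewrite (ltn_trans jk km) subrK.
  have [jm|mj] := ltnP j m; last by rewrite !mul0r subr0 addr0.
  rewrite mul1r mul0r addr0 lerBrDl -lerBrDr -sumrB (bigD1 j)//= ler_wpDr//.
  apply: sumr_ge0 => i /andP[im _]; rewrite subr_ge0 below//.
  exact: leq_trans mk.
- have all f : \sum_(i < n) f i = \sum_(i < n | (i < n)%N) f i :> R.
    by apply: eq_bigl => i; rewrite ltn_ord.
  by rewrite all sum_transfer !ltn_ord subrK -all.
Qed.

(** * Products of several zeta functions *)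

(** The extra factor h is there because the empty product 1 is not representable. *)
Lemma laplace_representable_prod (R : realType) (I : eqType) (s : seq I)
    (P : pred I) (G : I -> R -> R) (h : R -> R) :
  laplace_representable h -> (forall i, P i -> laplace_representable (G i)) ->
  laplace_representable (fun x => h x * \prod_(i <- s | P i) G i x).
Proof.
move=> Lh LG; elim: s => [|i s IH].
  by apply: laplace_representable_ext Lh => x _; rewrite big_nil mulr1.
have [Pi|Pi] := boolP (P i).
  apply: laplace_representable_ext (laplace_representableM (LG i Pi) IH) => x _.
  by rewrite big_cons Pi mulrCA.
by apply: laplace_representable_ext IH => x _; rewrite big_cons (negPf Pi).
Qed.

Lemma prodD2 (R : comRingType) (n : nat) (j k : 'I_n) (F : 'I_n -> R) : j != k ->
  \prod_(i < n) F i = F j * F k * \prod_(i < n | (i != j) && (i != k)) F i.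
Proof. by move=> jk; rewrite (bigD1 j)//= (bigD1 k) 1?eq_sym//= mulrA. Qed.

Lemma transfer_prod (R : realType) (n : nat) (q : 'I_n -> R) (j k : 'I_n)
    (d : R) (G : R -> R -> R) (x : R) : j != k ->
  \prod_(i < n) G (transfer q j k d i) x =
  G (q j - d) x * G (q k + d) x * \prod_(i < n | (i != j) && (i != k)) G (q i) x.
Proof.
move=> jk; rewrite (prodD2 _ jk); congr (G _ x * G _ x * _).
- by rewrite /transfer eqxx (negPf jk) mul1r mul0r addr0.
- by rewrite /transfer eqxx eq_sym (negPf jk) mul1r mul0r subr0.
- apply: eq_bigr => i /andP[/negPf ij /negPf ik].
  by rewrite /transfer ij ik !mul0r subr0 addr0.
Qed.

Lemma zeta_prod_majorized (R : realType) (n : nat) (p q : 'I_n -> R) :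
  (forall i, 1 < p i) -> (forall i, 1 < q i) ->
  (forall i j : 'I_n, (i <= j)%N -> p j <= p i) ->
  (forall m : nat, \sum_(i < n | (i < m)%N) p i <= \sum_(i < n | (i < m)%N) q i) ->
  \sum_(i < n) q i = \sum_(i < n) p i ->
  laplace_representable (fun x =>
    \prod_(i < n) hurwitz_zeta (q i) x - \prod_(i < n) hurwitz_zeta (p i) x).
Proof.
move=> p1 q1 pmono prefix total.
pose Rel (f g : 'I_n -> R) := laplace_representable (fun x =>
  \prod_(i < n) hurwitz_zeta (g i) x - \prod_(i < n) hurwitz_zeta (f i) x).
apply: (@majorization_ind R n 1 Rel p _ _ _ p1 pmono q q1 prefix total).
- move=> f; apply: laplace_representable_ext (@laplace_representable0 R) => x _.
  by rewrite subrr.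
- move=> f g h fg gh.
  apply: laplace_representable_ext (laplace_representableD fg gh) => x _.
  by rewrite addrC addrA subrK.
- move=> f j k d f1 jk d0 kj.
  apply: (@laplace_representable_ext _ (fun x =>
    (hurwitz_zeta (f j) x * hurwitz_zeta (f k) x -
     hurwitz_zeta (f j - d) x * hurwitz_zeta (f k + d) x) *
    \prod_(i < n | (i != j) && (i != k)) hurwitz_zeta (f i) x)).
    by move=> x _; rewrite transfer_prod// (prodD2 _ jk) mulrBl.
  apply: laplace_representable_prod; last by move=> i _; exact: zeta_representable.
  by apply: zeta_pair_representable => //; lra.
Qed.

Lemma weighted_zeta_prod_majorized (R : realType) (n : nat) (p q : 'I_n -> R) :
  (forall i, 1 < p i) -> (forall i, 1 < q i) ->
  (forall i j : 'I_n, (i <= j)%N -> p j <= p i) ->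
  (forall m : nat, \sum_(i < n | (i < m)%N) p i <= \sum_(i < n | (i < m)%N) q i) ->
  \sum_(i < n) q i = \sum_(i < n) p i ->
  laplace_representable (fun x =>
    \prod_(i < n) ((p i - 1) * hurwitz_zeta (p i) x) -
    \prod_(i < n) ((q i - 1) * hurwitz_zeta (q i) x)).
Proof.
move=> p1 q1 pmono prefix total.
pose G (a x : R) := (a - 1) * hurwitz_zeta a x.
pose Rel (f g : 'I_n -> R) := laplace_representable (fun x =>
  \prod_(i < n) G (f i) x - \prod_(i < n) G (g i) x).
apply: (@majorization_ind R n 1 Rel p _ _ _ p1 pmono q q1 prefix total).
- move=> f; apply: laplace_representable_ext (@laplace_representable0 R) => x _.
  by rewrite subrr.
- move=> f g h fg gh.
  apply: laplace_representable_ext (laplace_representableD fg gh) => x _.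
  by rewrite addrA subrK.
- move=> f j k d f1 jk d0 kj.
  apply: (@laplace_representable_ext _ (fun x =>
    (G (f j - d) x * G (f k + d) x - G (f j) x * G (f k) x) *
    \prod_(i < n | (i != j) && (i != k)) G (f i) x)).
    by move=> x _; rewrite transfer_prod// (prodD2 _ jk) mulrBl.
  apply: laplace_representable_prod.
    by apply: weighted_zeta_pair_representable => //; have := f1 k; lra.
  move=> i _; apply: laplace_representableZ; last exact: zeta_representable.
  by rewrite subr_ge0 ltW.
Qed.

Lemma prod_sub1_majorized (R : realFieldType) (n : nat) (p q : 'I_n -> R) :
  (forall i, 1 < p i) -> (forall i, 1 < q i) ->
  (forall i j : 'I_n, (i <= j)%N -> p j <= p i) ->
  (forall m : nat, \sum_(i < n | (i < m)%N) p i <= \sum_(i < n | (i < m)%N) q i) ->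
  \sum_(i < n) q i = \sum_(i < n) p i ->
  p = q \/ \prod_(i < n) (q i - 1) < \prod_(i < n) (p i - 1).
Proof.
move=> p1 q1 pmono prefix total.
apply: (@majorization_ind R n 1 (fun f g =>
  f = g \/ \prod_(i < n) (g i - 1) < \prod_(i < n) (f i - 1)) p) => //.
- by left.
- move=> f g h [->//|fg] [<-|gh]; right => //.
  exact: lt_trans fg.
- move=> f j k d f1 jk d0 kj; right.
  rewrite (prodD2 _ jk) [ltRHS](prodD2 _ jk).
  have -> : \prod_(i < n | (i != j) && (i != k)) (transfer f j k d i - 1) =
            \prod_(i < n | (i != j) && (i != k)) (f i - 1).
    apply: eq_bigr => i /andP[/negPf ij /negPf ik].
    by rewrite /transfer ij ik !mul0r subr0 addr0.
  rewrite ltr_pM2r; last by apply: prodr_gt0 => i _; rewrite subr_gt0.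
  rewrite /transfer !eqxx [k == j]eq_sym (negPf jk) !mul1r !mul0r addr0 subr0.
  rewrite -subr_gt0.
  have -> : (f j - d - 1) * (f k + d - 1) - (f j - 1) * (f k - 1) =
    d * (f j - f k - d) by ring.
  by rewrite mulr_gt0//; lra.
Qed.

Lemma prod_powR (R : realType) (I : Type) (s : seq I) (x : R) (e : I -> R) :
  0 < x -> \prod_(i <- s) x `^ e i = x `^ (\sum_(i <- s) e i).
Proof.
move=> x0; elim: s => [|i s IH]; first by rewrite !big_nil powRr0.
by rewrite !big_cons IH powRD// (gt_eqF x0) implybT.
Qed.

Lemma le_one_of_prod_harmonic (R : realType) (n : nat) (d : 'I_n -> R) (c : R) :
  (forall N : nat, c <= \prod_(i < n) (1 + d i / N.+1%:R)) -> c <= 1.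
Proof.
move=> H.
have lim s : (fun N : nat => \prod_(i <- s) (1 + d i / N.+1%:R)) @ \oo --> (1 : R).
  elim: s => [|i s IH].
    rewrite (_ : (fun _ => _) = cst 1); first exact: cvg_cst.
    by apply/funext => N; rewrite big_nil.
  rewrite (_ : (fun _ => _) = (fun N : nat => (1 + d i / N.+1%:R) *
    \prod_(j <- s) (1 + d j / N.+1%:R))); last by apply/funext => N; rewrite big_cons.
  have h : (fun N : nat => 1 + d i / N.+1%:R) @ \oo --> 1 + d i * 0.
    apply: cvgD; first exact: cvg_cst.
    by apply: cvgM; [exact: cvg_cst|exact: cvg_harmonic].
  have := cvgM h IH; rewrite mulr0 addr0 mulr1; exact.
have <- := cvg_lim _ (lim (index_enum 'I_n)); last by [].
apply: limr_ge; first by apply/cvg_ex; exists 1; exact: lim.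
by near=> N; exact: H.
Unshelve. all: by end_near. Qed.

(** * Bounds at large and small arguments, and the theorem *)

Lemma majorized_prefix (R : realType) (n : nat) (p q : 'rV[R]_n) (m : nat) :
  majorized p q ->
  \sum_(j < n | (j < m)%N) p ord0 j <= \sum_(j < n | (j < m)%N) q ord0 j.
Proof.
case=> _ _ _ prefix total; have [m0|m0] := posnP m.
  by rewrite !big_pred0// => j; rewrite m0.
have [mn|nm] := leqP m n.-1; first by rewrite prefix// m0.
have nm' : (n <= m)%N by case: (n) nm.
have all (f : 'I_n -> R) : \sum_(j < n | (j < m)%N) f j = \sum_(j < n) f j.
  by apply: eq_bigl => j; rewrite (leq_trans (ltn_ord j)).
by rewrite !all total.
Qed.

(** As sum p_j = sum q_j, the powers x^{1-p_j} and x^{1-q_j} have the same product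
    and drop out; at x = N + 1 the remaining factors tend to 1. *)
Lemma zeta_ratio_upper (R : realType) (n : nat) (p q : 'I_n -> R) (N : nat) :
  (forall i, 1 < p i) -> (forall i, 1 < q i) ->
  \sum_(i < n) q i = \sum_(i < n) p i ->
  \prod_(i < n) (hurwitz_zeta (p i) N.+1%:R / hurwitz_zeta (q i) N.+1%:R) <=
  \prod_(i < n) ((q i - 1) / (p i - 1)) * \prod_(i < n) (1 + (p i - 1) / N.+1%:R).
Proof.
move=> p1 q1 total.
set x : R := N.+1%:R; have x0 : 0 < x by rewrite ltr0n.
have powE : \prod_(i < n) x `^ (1 - p i) = \prod_(i < n) x `^ (1 - q i).
  by rewrite !prod_powR// !sumrB total.
have upper : \prod_(i < n) ((p i - 1) * hurwitz_zeta (p i) x) <=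
    \prod_(i < n) ((q i - 1) * hurwitz_zeta (q i) x) *
    \prod_(i < n) (1 + (p i - 1) / x).
  apply: (@le_trans _ _ (\prod_(i < n) x `^ (1 - p i) *
      \prod_(i < n) (1 + (p i - 1) / x))).
    rewrite -big_split/=; apply: ler_prod => i _.
    have [_ _ h] := hurwitz_bounds (p1 i) x0.
    apply/andP; split.
      by rewrite mulr_ge0 ?subr_ge0 ?(ltW (p1 i)) ?(ltW (hurwitz_gt0 (p1 i) x0)).
    apply: le_trans h _.
    rewrite powRD ?(gt_eqF x0) ?implybT// powRr1 ?(ltW x0)//.
    by rewrite le_eqVlt; apply/orP; left; apply/eqP; field; rewrite gt_eqF.
  apply: ler_wpM2r.
    by apply: prodr_ge0 => i _; rewrite addr_ge0 ?divr_ge0 ?subr_ge0 ?(ltW (p1 i)) ?(ltW x0).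
  rewrite powE; apply: ler_prod => i _; rewrite powR_ge0/=.
  by have [_ h _] := hurwitz_bounds (q1 i) x0.
have Zq : 0 < \prod_(i < n) hurwitz_zeta (q i) x.
  by apply: prodr_gt0 => i _; exact: hurwitz_gt0.
have V : 0 < \prod_(i < n) (p i - 1) by apply: prodr_gt0 => i _; rewrite subr_gt0.
rewrite !prodf_div ler_pdivrMr// -!mulrA mulrCA ler_pdivlMl//.
move: upper; rewrite !big_split/= => h.
by apply: le_trans h _; rewrite le_eqVlt; apply/orP; left; apply/eqP; ring.
Qed.

(** The same comparison near 0, at x = 1/(N+1), with the powers x^{-p_j}. *)
Lemma zeta_ratio_lower (R : realType) (n : nat) (p q : 'I_n -> R) (N : nat) :
  (forall i, 1 < p i) -> (forall i, 1 < q i) ->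
  \sum_(i < n) q i = \sum_(i < n) p i ->
  1 <= \prod_(i < n) (hurwitz_zeta (p i) N.+1%:R^-1 / hurwitz_zeta (q i) N.+1%:R^-1)
    * \prod_(i < n) (1 + (q i - 1)^-1 / N.+1%:R).
Proof.
move=> p1 q1 total.
set x : R := N.+1%:R^-1; have x0 : 0 < x by rewrite invr_gt0 ltr0n.
have powE : \prod_(i < n) x `^ (- p i) = \prod_(i < n) x `^ (- q i).
  by rewrite !prod_powR// !sumrN total.
have Zq : 0 < \prod_(i < n) hurwitz_zeta (q i) x.
  by apply: prodr_gt0 => i _; exact: hurwitz_gt0.
rewrite prodf_div mulrAC ler_pdivlMr// mul1r.
apply: (@le_trans _ _ (\prod_(i < n) x `^ (- q i) *
    \prod_(i < n) (1 + (q i - 1)^-1 * x))).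
  rewrite -big_split/=; apply: ler_prod => i _.
  have [_ _ h] := hurwitz_bounds (q1 i) x0.
  have qi0 : 0 < q i - 1 by rewrite subr_gt0.
  rewrite (ltW (hurwitz_gt0 (q1 i) x0))/= -(ler_pM2l qi0).
  apply: le_trans h _.
  rewrite powRD ?(gt_eqF x0) ?implybT// powRr1 ?(ltW x0)//.
  by rewrite le_eqVlt; apply/orP; left; apply/eqP; field; rewrite gt_eqF.
apply: ler_wpM2r.
  by apply: prodr_ge0 => i _; rewrite addr_ge0// mulr_ge0 ?invr_ge0 ?subr_ge0
    ?(ltW x0) ?(ltW (q1 i)).
rewrite -powE; apply: ler_prod => i _; rewrite powR_ge0/=.
by have [h _ _] := hurwitz_bounds (p1 i) x0.
Qed.

Theorem proposition2 (R : realType) (n : nat) (p q : 'rV[R]_n)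
    (hn : (2 <= n)%N)
    (hp : forall j : 'I_n, 1 < p ord0 j)
    (hq : forall j : 'I_n, 1 < q ord0 j)
    (hpq : majorized p q) :
  (forall lambda : R,
     completely_monotonic `]0, +oo[ (fun x => zeta_prod_diff p q lambda x)
     <-> lambda <= \prod_(j < n) ((q ord0 j - 1) / (p ord0 j - 1))) /\
  (forall lambda : R,
     completely_monotonic `]0, +oo[ (fun x => - zeta_prod_diff p q lambda x)
     <-> 1 <= lambda) /\
  (forall x : R, 0 < x ->
     \prod_(j < n) ((q ord0 j - 1) / (p ord0 j - 1))
       < \prod_(j < n) (hurwitz_zeta (p ord0 j) x / hurwitz_zeta (q ord0 j) x)
     /\
     \prod_(j < n) (hurwitz_zeta (p ord0 j) x / hurwitz_zeta (q ord0 j) x) < 1) /\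
  (forall c : R,
     (forall x : R, 0 < x ->
        c <= \prod_(j < n) (hurwitz_zeta (p ord0 j) x / hurwitz_zeta (q ord0 j) x)) ->
     c <= \prod_(j < n) ((q ord0 j - 1) / (p ord0 j - 1))) /\
  (forall c : R,
     (forall x : R, 0 < x ->
        \prod_(j < n) (hurwitz_zeta (p ord0 j) x / hurwitz_zeta (q ord0 j) x) <= c) ->
     1 <= c).
Proof.
have prefix m := @majorized_prefix R n p q m hpq.
have [qNp _ pmono _ total] := hpq.
set kappa := \prod_(j < n) ((q ord0 j - 1) / (p ord0 j - 1)).
pose Zp x := \prod_(j < n) hurwitz_zeta (p ord0 j) x.
pose Zq x := \prod_(j < n) hurwitz_zeta (q ord0 j) x.
pose V := \prod_(j < n) (p ord0 j - 1).
pose W := \prod_(j < n) (q ord0 j - 1).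
have kappaE : kappa = W / V by rewrite /kappa prodf_div.
have V0 : 0 < V by apply: prodr_gt0 => j _; rewrite subr_gt0.
have W0 : 0 < W by apply: prodr_gt0 => j _; rewrite subr_gt0.
have kappa0 : 0 < kappa by rewrite kappaE divr_gt0.
have kappa1 : kappa < 1.
  rewrite kappaE ltr_pdivrMr// mul1r.
  have [pq|//] := prod_sub1_majorized hp hq pmono prefix total.
  by exfalso; apply: qNp; apply/rowP => j; have /(congr1 (fun f => f j)) := pq.
have ratioE x : \prod_(j < n) (hurwitz_zeta (p ord0 j) x / hurwitz_zeta (q ord0 j) x)
    = Zp x / Zq x by rewrite prodf_div.
have Zp0 x : 0 < x -> 0 < Zp x by move=> x0; apply: prodr_gt0 => j _; exact: hurwitz_gt0.
have Zq0 x : 0 < x -> 0 < Zq x by move=> x0; apply: prodr_gt0 => j _; exact: hurwitz_gt0.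
have sharp_lower (c : R) : (forall x, 0 < x -> c <= Zp x / Zq x) -> c <= kappa.
  move=> H; rewrite -[leRHS]mulr1 -ler_pdivrMl//.
  apply: (@le_one_of_prod_harmonic R n (fun j => p ord0 j - 1)) => N.
  rewrite ler_pdivrMl//; apply: le_trans (H N.+1%:R (ltr0Sn _ _)) _.
  by rewrite -ratioE; exact: zeta_ratio_upper.
have sharp_upper (c : R) : (forall x, 0 < x -> Zp x / Zq x <= c) -> 1 <= c.
  move=> H; have c0 : 0 < c.
    exact: lt_le_trans (divr_gt0 (Zp0 1 ltr01) (Zq0 1 ltr01)) (H 1 ltr01).
  rewrite -invf_le1//.
  apply: (@le_one_of_prod_harmonic R n (fun j => (q ord0 j - 1)^-1)) => N.
  rewrite -[leLHS]mulr1 ler_pdivrMl//.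
  apply: le_trans (zeta_ratio_lower N hp hq total) _.
  apply: ler_wpM2r.
    apply: prodr_ge0 => j _; rewrite addr_ge0// divr_ge0// invr_ge0 subr_ge0.
    exact: ltW.
  by rewrite ratioE; apply: H; rewrite invr_gt0 ltr0Sn.
have LZq : laplace_representable Zq.
  have j0 : 'I_n by exact: Ordinal (ltnW hn).
  apply: (@laplace_representable_ext _ (fun x => hurwitz_zeta (q ord0 j0) x *
      \prod_(j < n | j != j0) hurwitz_zeta (q ord0 j) x)).
    by move=> x _; rewrite /Zq [RHS](bigD1 j0).
  apply: laplace_representable_prod; first exact: zeta_representable.
  by move=> j _; exact: zeta_representable.
have Lupper : laplace_representable (fun x => Zq x - Zp x).
  exact: zeta_prod_majorized hp hq pmono prefix total.
have Llower : laplace_representable (fun x => Zp x - kappa * Zq x).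
  have L := weighted_zeta_prod_majorized hp hq pmono prefix total.
  have V1 : 0 <= V^-1 by rewrite invr_ge0 ltW.
  apply: laplace_representable_ext (laplace_representableZ V1 L) => x _.
  rewrite !big_split/= -/V -/W -/(Zp x) -/(Zq x) kappaE mulrBr mulKf ?gt_eqF//.
  by rewrite mulrA [V^-1 * W]mulrC.
have cm_ge0 (f : R -> R) (x : R) : completely_monotonic `]0, +oo[ f -> 0 < x -> 0 <= f x.
  move=> [_ /(_ 0%N x)]; rewrite /= in_itv/= andbT expr0 mul1r => H x0.
  exact: H.
split; [|split; [|split; [|split]]].
- move=> lambda; split.
    move=> cm; apply: sharp_lower => x x0; rewrite ler_pdivlMr ?Zq0//.
    by rewrite -subr_ge0; exact: cm_ge0 cm x0.
  move=> lk; apply: laplace_representable_cm.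
  have lk0 : 0 <= kappa - lambda by rewrite subr_ge0.
  apply: laplace_representable_ext
    (laplace_representableD Llower (laplace_representableZ lk0 LZq)) => x _.
  by rewrite /zeta_prod_diff -/(Zp x) -/(Zq x); ring.
- move=> lambda; split.
    move=> cm; apply: sharp_upper => x x0; rewrite ler_pdivrMr ?Zq0//.
    by have := cm_ge0 _ _ cm x0; rewrite opprB subr_ge0.
  move=> l1; apply: laplace_representable_cm.
  have l0 : 0 <= lambda - 1 by rewrite subr_ge0.
  apply: laplace_representable_ext
    (laplace_representableD Lupper (laplace_representableZ l0 LZq)) => x _.
  by rewrite /zeta_prod_diff -/(Zp x) -/(Zq x); ring.
- move=> x x0; rewrite ratioE; split.
    rewrite ltr_pdivlMr ?Zq0// -subr_gt0 lt_def (laplace_representable_ge0 Llower x0) andbT.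
    apply/eqP => D0.
    have : 1 <= kappa.
      apply: sharp_upper => y y0; rewrite ler_pdivrMr ?Zq0//.
      by rewrite -subr_le0 (laplace_representable_vanish Llower x0 y0 D0).
    by rewrite leNgt kappa1.
  rewrite ltr_pdivrMr ?Zq0// mul1r -subr_gt0 lt_def (laplace_representable_ge0 Lupper x0) andbT.
  apply/eqP => D0.
  have : 1 <= kappa.
    apply: sharp_lower => y y0; rewrite ler_pdivlMr ?Zq0// mul1r.
    by rewrite -subr_le0 (laplace_representable_vanish Lupper x0 y0 D0).
  by rewrite leNgt kappa1.
- by move=> c H; apply: sharp_lower => x x0; rewrite -ratioE; exact: H.
- by move=> c H; apply: sharp_upper => x x0; rewrite -ratioE; exact: H.
Qed.
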